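(* Let $T:L_1(\Omega,X)\rightarrow L_1(\Omega,X)$ be a linear operator positively dominated by an $L_1-L_\infty$ contraction in $L_1$, and let $S_ng=\frac1n\sum_{i=0}^{n-1}T^ig$. If $f\in L_p(\Omega,X)$, $p>1$, and $\sup_{n_2}\|E(f|F_{n_2})\|_X\in L_1$, then 1. $$\Big\|\sup_{n_1,n_2}\|S_{n_1}E(f|F_{n_2})\|_X\Big\|_p\le\left(\frac p{p-1}\right)^2\|f\|_p.$$ 2. For every $\varepsilon>0$, $$\mu\Big\{\sup_{n_1,n_2}\|S_{n_1}E(f|F_{n_2})\|_X\ge\varepsilon\Big\}\le\left(\frac p{p-1}\right)^p\frac{\|f\|_p^p}{\varepsilon^p}.$$
   Context: $X$ is a reflexive Banach space with norm $\|\cdot\|_X$, and $(\Omega,\beta,\mu)$ is a finite measure space. For $1\le p<\infty$, $L_p(\Omega,X)$ is the Banach space of (strongly) measurable functions $f:\Omega\to X$ with finite norm $\|f\|_p=\left(\int_\Omega\|f(\omega)\|_X^p\,d\mu\right)^{1/p}$, and $\|f\|_\infty=\inf\{\lambda:\|f(\omega)\|_X\le\lambda\text{ a.e.}\}$; $L_p$ denotes the space for $X=\mathbb R$. For $f$ with values in $X$, $\|f\|_X$ denotes the function $\omega\mapsto\|f(\omega)\|_X$. $E(f|F)$ is the conditional expectation of $f$ with respect to a $\sigma$-subalgebra $F\subset\beta$. $(F_n)_{n\ge1}$ is a monotone (increasing or decreasing) sequence of $\sigma$-subalgebras of $\beta$, with $F_n\uparrow F_\infty$ or $F_n\downarrow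 F_\infty$. A linear operator $T$ in $L_1(\Omega,X)$ is positively dominated if there is a positive linear contraction $T'$ in $L_1$, called a positive dominant of $T$, with $\|Tf\|_X\le T'(\|f\|_X)$ a.e. for all $f$; one then says $T$ is positively dominated by $T'$. A linear operator is an $L_1-L_\infty$ contraction if $\|Tf\|_1\le\|f\|_1$ and $\|Tf\|_\infty\le\|f\|_\infty$. *)

(* Defs.v *)
From HB Require Import structures.
From mathcomp Require Import all_boot all_order all_algebra.
From mathcomp Require Import all_classical all_reals all_analysis.

Set Implicit Arguments.
Unset Strict Implicit.
Unset Printing Implicit Defensive.

Import Order.TTheory GRing.Theory Num.Theory.
Import numFieldNormedType.Exports.

Local Open Scope classical_set_scope.
Local Open Scope ring_scope.

Section Reflexivity.
Context {R : realType} (X : normedModType R).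

Definition dual : set (X -> R^o) :=
  [set phi | linear phi /\ continuous phi].

Definition dual_norm (phi : X -> R^o) : R :=
  sup [set `|phi x| | x in [set x : X | `|x| <= 1]].

(* Only the values of Phi on [dual] are meaningful. *)
Definition bidual : set ((X -> R^o) -> R) :=
  [set Phi |
    (forall (a : R) phi psi, dual phi -> dual psi ->
      Phi (fun x => a * phi x + psi x) = a * Phi phi + Phi psi) /\
    (exists C : R, forall phi, dual phi -> `|Phi phi| <= C * dual_norm phi)].

Definition reflexive_space : Prop :=
  forall Phi, bidual Phi -> exists x : X, forall phi, dual phi -> Phi phi = phi x.

End Reflexivity.

Section BochnerSpaces.
Context {d : measure_display} {Omega : measurableType d} {R : realType}.
Context (mu : {finite_measure set Omega -> \bar R}) {X : completeNormedModType R}.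
Implicit Types (G : set (set Omega)) (f g s : Omega -> X) (A : set Omega).

(* Measurability is relative to an arbitrary sigma-algebra G, so that it also
   applies to sub-sigma-algebras. *)
Definition simple G s : Prop :=
  finite_set (range s) /\ forall x, G (s @^-1` [set x]).

(* Limits are taken everywhere rather than a.e.; every a.e. limit of simple
   functions is a.e. equal to such a function. *)
Definition strongly_measurable G f : Prop :=
  exists s : (Omega -> X)^nat,
    (forall n, simple G (s n)) /\ forall w, s n w @[n --> \oo] --> f w.

Definition Lpnorm (p : \bar R) f : \bar R := Lnorm mu p (fun w => (`|f w|)%:E).

Definition Lp (p : \bar R) : set (Omega -> X) :=
  [set f | strongly_measurable measurable f /\ (Lpnorm p f < +oo)%E].

Definition simple_integral A s : X :=
  \sum_(x \in range s) fine (mu (A `&` s @^-1` [set x])) *: x.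

Definition is_bochner_integral A f (x : X) : Prop :=
  exists s : (Omega -> X)^nat,
    [/\ forall n, simple measurable (s n),
        (\int[mu]_(w in A) (`|f w - s n w|)%:E)%E @[n --> \oo] --> 0%E &
        simple_integral A (s n) @[n --> \oo] --> x].

Definition bochner_integral A f : X := xget 0 (is_bochner_integral A f).

Definition sub_sigma_algebra_of G : Prop :=
  sigma_algebra setT G /\ G `<=` measurable.

(* g is a version of E(f | G). *)
Definition is_cond_exp G f g : Prop :=
  [/\ strongly_measurable G g, Lp 1 g &
      forall A, G A -> bochner_integral A g = bochner_integral A f].

(* Elements of L_1 are represented by functions: an operator acts on
   representatives and respects a.e. equality. *)
Definition L1_linear_operator (T : (Omega -> X) -> Omega -> X) : Prop :=
  [/\ forall f, Lp 1 f -> Lp 1 (T f),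
      forall f g, Lp 1 f -> Lp 1 g -> f = g %[ae mu] -> T f = T g %[ae mu] &
      forall (a : R) f g, Lp 1 f -> Lp 1 g ->
        T (fun w => a *: f w + g w) = (fun w => a *: T f w + T g w) %[ae mu]].

Definition L1_contraction (T : (Omega -> X) -> Omega -> X) : Prop :=
  forall f, Lp 1 f -> (Lpnorm 1 (T f) <= Lpnorm 1 f)%E.

(* The second bound is vacuous for f outside L_oo, where its right-hand side
   is +oo. *)
Definition L1_Loo_contraction (T : (Omega -> X) -> Omega -> X) : Prop :=
  L1_contraction T /\
  forall f, Lp 1 f -> (Lpnorm +oo (T f) <= Lpnorm +oo f)%E.

Definition ergodic_average (T : (Omega -> X) -> Omega -> X) (n : nat) g :
    Omega -> X :=
  fun w => n%:R^-1 *: \sum_(i < n) iter i T g w.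

End BochnerSpaces.

Section PositiveDomination.
Context {d : measure_display} {Omega : measurableType d} {R : realType}.
Context (mu : {finite_measure set Omega -> \bar R}).

Definition L1_positive (T' : (Omega -> R^o) -> Omega -> R^o) : Prop :=
  forall h, Lp mu 1 h -> {ae mu, forall w, (0 : R) <= h w} ->
    {ae mu, forall w, (0 : R) <= T' h w}.

Definition positive_dominant (X : completeNormedModType R)
    (T : (Omega -> X) -> Omega -> X)
    (T' : (Omega -> R^o) -> Omega -> R^o) : Prop :=
  [/\ L1_linear_operator mu T', L1_positive T', L1_contraction mu T' &
      forall f, Lp mu 1 f ->
        {ae mu, forall w, (`|T f w| : R) <= T' (fun w' => `|f w'|) w}].

End PositiveDomination.

Section MonotoneSigmaAlgebras.
Context {Omega : Type} (F : nat -> set (set Omega)) (Foo : set (set Omega)).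

Definition increases_to : Prop :=
  (forall m n, (m <= n)%N -> F m `<=` F n) /\ Foo = <<s \bigcup_n F n >>.

Definition decreases_to : Prop :=
  (forall m n, (m <= n)%N -> F n `<=` F m) /\ Foo = \bigcap_n F n.

End MonotoneSigmaAlgebras.

(* Main.v *)
Require Import Defs.
From HB Require Import structures.
From mathcomp Require Import all_boot all_order all_algebra.
From mathcomp Require Import all_classical all_reals all_analysis.
From mathcomp Require Import measurable_realfun ess_sup_inf.
From mathcomp Require Import ring lra.

Set Implicit Arguments.
Unset Strict Implicit.
Unset Printing Implicit Defensive.

Import Order.TTheory GRing.Theory Num.Theory.
Import numFieldNormedType.Exports.

Local Open Scope classical_set_scope.
Local Open Scope ring_scope.

(** The estimates come from composing two weak type (1,1) maximal inequalities,
    Doob's and Hopf's.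

    Put [h := sup_n |E(f|F_n)|], which is in [L_1], and let [P] be the positive
    dominant of [T].  By positivity of [P], [|T^i E(f|F_n)| <= P^i h] a.e., so
    the supremum over both indices is at most [sup_n A_n h], where [A_n] are the
    ergodic averages of [P] ([dominated_average]).  The double supremum is thus
    reduced to two real maximal functions, each controlled by an inequality of
    one and the same form: for all [l > 0],
      [l * mu {U > l} <= \int_{U > l} V].

    For [U = h] and [V = |f|] this is Doob's inequality ([doob_weak]): split
    [{max_(n <= N) |E(f|F_n)| > l}] according to the first index (the last one,
    when the sigma-algebras decrease) at which [|E(f|F_n)| > l], use that
    conditional expectation decreases [\int_A |.|] for [A] in [F_n]
    ([cond_exp_norm_contraction]), and let [N] tend to infinity.  For
    [U = sup_n A_n h] and [V = h] it is the maximal ergodic inequality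
    ([ergodic_maximal_weak]), obtained by Garsia's argument.

    Any pair [U, V] with this property satisfies
      [\int U^p <= (p / (p - 1))^p \int V^p] and
      [l^p mu {U >= l} <= \int V^p]
    ([strong_of_weak], [weak_Lp_of_weak_ge]).  The strong estimate applied to
    both pairs gives the factor [(p / (p - 1))^2] of the first claim; the weak
    [L_p] estimate for the ergodic pair and the strong one for Doob's pair give
    the second.

    The vector-valued part of the argument is the contraction property of
    conditional expectation.  Since the Bochner integral is given by
    approximating sequences, its existence for [L_1] functions has to come from
    completeness of [X] ([bochner_integralP]). *)

(** * The layer cake formula *)

Lemma measurable_ltr_set {R : realType} {d} {T : measurableType d}
    (f g : T -> R) :
  measurable_fun setT f -> measurable_fun setT g ->
  measurable [set t | f t < g t].
Proof.
move=> mf mg; have := measurable_fun_ltr mf mg.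
by move=> /(_ measurableT [set true]); rewrite setTI; exact.
Qed.

Section LayerCake.
Context {R : realType}.
Local Notation leb := (@lebesgue_measure R).

(** The exponent [a - 1] may be negative, hence a lower bound [x > 0] instead of
    an improper integral from [0]. *)
Lemma integral_powR_oo (a x y : R) : 0 < x -> x <= y ->
  (\int[leb]_(l in `]x, y[) (a * l `^ (a - 1))%:E = (y `^ a - x `^ a)%:E)%E.
Proof.
move=> x0; rewrite le_eqVlt => /predU1P[->|xy].
  by rewrite set_itvoo0 integral_set0 subrr.
rewrite -(@integral_itv_bndoo _ x y _ true false); last first.
  apply/measurable_EFinP; apply: measurable_funM => //.
  by apply: measurable_funTS; exact: measurable_powR.
apply: (@continuous_FTC2 _ (fun l => a * l `^ (a - 1)) (fun l => l `^ a) x y xy).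
- apply: derivable_within_continuous => l.
  rewrite in_itv/= => /andP[xl _]; apply: derivableM => //.
  by apply: derivable_powR; rewrite in_itv/= andbT (lt_le_trans x0).
- have der z : 0 < z -> derivable (fun l : R => l `^ a) z 1.
    by move=> z0; apply: derivable_powR; rewrite in_itv/= andbT.
  have cont z : 0 < z -> {for z, continuous (fun l : R => l `^ a)}.
    move=> z0; apply: differentiable_continuous.
    exact/derivable1_diffP/der.
  split.
  + by move=> z; rewrite in_itv/= => /andP[xz _]; exact/der/(lt_trans x0).
  + exact/cvg_at_right_filter/cont.
  + exact/cvg_at_left_filter/cont/(lt_trans x0).
- move=> z; rewrite in_itv/= => /andP[xz _]; rewrite powR_derive1//.
  by rewrite in_itv/= andbT (lt_trans x0).
Qed.

Context {d} {T : measurableType d} (mu : {finite_measure set T -> \bar R}).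

(** Tonelli's theorem applied to [V t * (a l^(a-1))] on the region
    [x < l < W t]: integrating in [l] first yields [W^a - x^a], integrating in
    [t] first yields the superlevel sets of [W]. *)
Lemma layer_cake (W V : T -> R) (x a : R) : 0 < x -> 0 < a ->
  measurable_fun setT W -> measurable_fun setT V ->
  (forall t, x <= W t) -> (forall t, 0 <= V t) ->
  (\int[mu]_t (V t * (W t `^ a - x `^ a))%:E =
   \int[leb]_(l in `]x, +oo[) ((a * l `^ (a - 1))%:E *
     \int[mu]_(t in [set t | (l < W t)%R]) (V t)%:E))%E.
Proof.
move=> x0 a0 mW mV xW V0.
pose A := [set z : T * measurableTypeR R | x < z.2 /\ z.2 < W z.1].
have mA : measurable A.
  rewrite (_ : A = [set z | x < z.2] `&` [set z | z.2 < W z.1]);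
    last by apply/seteqP; split => z.
  by apply: measurableI; apply: measurable_ltr_set => //; exact: measurableT_comp.
pose f (z : T * measurableTypeR R) : \bar R :=
  (V z.1 * (a * z.2 `^ (a - 1)) * \1_A z)%:E.
have mf : measurable_fun setT f.
  apply/measurable_EFinP; apply: measurable_funM => //.
  apply: measurable_funM; first exact: (measurableT_comp mV measurable_fst).
  apply: measurable_funM => //.
  exact: (measurableT_comp (measurable_powR _) measurable_snd).
have f0 z : (0 <= f z)%E.
  rewrite lee_fin mulr_ge0// mulr_ge0// mulr_ge0 ?powR_ge0//.
  exact: ltW.
transitivity (\int[mu]_t \int[leb]_l f (t, l))%E.
  apply: eq_integral => t _; rewrite EFinM -integral_powR_oo// -ge0_integralZl//.
  - rewrite integral_mkcond; apply: eq_integral => l _.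
    rewrite /f /= patchE indicE/=; case: ifPn => [|].
      rewrite inE/= in_itv/= => xlW; rewrite mem_set ?mulr1 -?EFinM//.
      by apply/andP.
    rewrite notin_setE/= in_itv/= => xlW; rewrite memNset ?mulr0//.
    by move=> [/= ? ?]; apply: xlW; apply/andP.
  - apply/measurable_EFinP; apply: measurable_funM => //.
    by apply: measurable_funTS; exact: measurable_powR.
  - by move=> l _; rewrite lee_fin mulr_ge0 ?powR_ge0// ltW.
  - by rewrite lee_fin.
rewrite (@fubini_tonelli _ _ _ _ _ mu leb f)//.
rewrite [RHS]integral_mkcond/=; apply: eq_integral => l _.
have mWl : measurable [set t | l < W t] by exact: measurable_ltr_set.
rewrite patchE; case: ifPn => [|].
  rewrite inE/= in_itv/= andbT => xl.
  rewrite -ge0_integralZl//; last 3 first.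
  - by apply/measurable_EFinP; exact: measurable_funTS.
  - by move=> t _; rewrite lee_fin.
  - by rewrite lee_fin mulr_ge0 ?powR_ge0// ltW.
  rewrite [RHS]integral_mkcond; apply: eq_integral => t _.
  rewrite /f /= patchE indicE/=; case: ifPn => [|].
    by rewrite inE/= => lW; rewrite mem_set ?mulr1// -EFinM mulrC.
  rewrite notin_setE/= => lW; rewrite memNset ?mulr0//.
  by move=> [/= ? ?]; exact: lW.
rewrite notin_setE/= in_itv/= andbT => xl.
apply: integral0_eq => t _; rewrite /f indicE memNset ?mulr0//.
by move=> [/= ? ?]; exact: xl.
Qed.

End LayerCake.

(** * From the weak maximal inequality to L_p *)

Section StrongType.
Context {R : realType} {d} {T : measurableType d}.
Context (mu : {finite_measure set T -> \bar R}).
Local Notation leb := (@lebesgue_measure R).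

Lemma measurable_integral_superlevel (W V : T -> R) :
  measurable_fun setT W -> measurable_fun setT V -> (forall t, 0 <= V t) ->
  measurable_fun setT
    (fun l : R => (\int[mu]_(t in [set t | (l < W t)%R]) (V t)%:E)%E).
Proof.
move=> mW mV V0.
pose A := [set z : T * measurableTypeR R | z.2 < W z.1].
have mA : measurable A.
  by apply: measurable_ltr_set => //; exact: measurableT_comp.
pose f (z : T * measurableTypeR R) : \bar R := (V z.1 * \1_A z)%:E.
have mf : measurable_fun setT f.
  apply/measurable_EFinP; apply: measurable_funM => //.
  exact: (measurableT_comp mV measurable_fst).
have f0 z : (0 <= f z)%E by rewrite lee_fin mulr_ge0.
have := @measurable_fun_fubini_tonelli_G _ _ _ _ _ mu f mf f0.
apply: eq_measurable_fun => l _; rewrite /fubini_G [RHS]integral_mkcond.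
apply: eq_integral => t _; rewrite /f /= patchE indicE/=; case: ifPn => [|].
  by rewrite inE/= => lW; rewrite mem_set ?mulr1.
by rewrite notin_setE/= => lW; rewrite memNset ?mulr0.
Qed.

(** Apply the layer cake formula to [\int W^p], insert the weak inequality, and
    recognize a layer cake formula for [\int V W^(p-1)]; with [q := p/(p-1)],
    this reads [\int W^p <= x^p mu(T) + q \int V W^(p-1)].  Young's inequality
    [q V W^(p-1) <= (q V)^p / p + W^p / q] then lets the last term be absorbed in
    the left-hand side.  The bound [K] makes that term finite; the bound [x]
    avoids the singularity of [l^(p-2)] at [0]. *)
Lemma strong_of_weak_bounded (W V : T -> R) (p x K : R) : 1 < p -> 0 < x ->
  measurable_fun setT W -> measurable_fun setT V ->
  (forall t, x <= W t <= K) -> (forall t, 0 <= V t) ->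
  (forall l, x < l -> (l%:E * mu [set t | (l < W t)%R] <=
    \int[mu]_(t in [set t | (l < W t)%R]) (V t)%:E)%E) ->
  (\int[mu]_t (W t `^ p)%:E <= (p * x `^ p)%:E * mu setT +
    ((p / (p - 1)) `^ p)%:E * \int[mu]_t (V t `^ p)%:E)%E.
Proof.
move=> p1 x0 mW mV xWK V0 weak.
have p0 : 0 < p by exact: lt_trans p1.
have p10 : 0 < p - 1 by rewrite subr_gt0.
have xW t : x <= W t by case/andP: (xWK t).
have W0 t : 0 < W t by exact: lt_le_trans (xW t).
set q := p / (p - 1).
have q0 : 0 < q by rewrite divr_gt0.
have mWp a : measurable_fun setT (fun t => W t `^ a).
  exact: (measurableT_comp (measurable_powR a) mW).
have mVp a : measurable_fun setT (fun t => V t `^ a).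
  exact: (measurableT_comp (measurable_powR a) mV).
have mlp a : measurable_fun setT (fun l : R => l `^ a) by exact: measurable_powR.
have mWl l : measurable [set t | l < W t] by exact: measurable_ltr_set.
set I := (\int[mu]_t (W t `^ p)%:E)%E.
have Ifin : I \is a fin_num.
  rewrite ge0_fin_numE; last first.
    by apply: integral_ge0 => t _; rewrite lee_fin powR_ge0.
  apply: (@le_lt_trans _ _ (\int[mu]_t (cst (K `^ p)%:E) t)%E).
    apply: ge0_le_integral => //.
    - by move=> t _; rewrite lee_fin powR_ge0.
    - exact/measurable_EFinP.
    - move=> t _; rewrite lee_fin ge0_ler_powR ?nnegrE//; first exact: ltW.
      + exact: ltW.
      + by rewrite (le_trans _ (proj2 (andP (xWK t))))// ltW.
      + by case/andP: (xWK t).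
  by rewrite integral_cst// lte_mul_pinfty// ?lee_fin ?powR_ge0// fin_num_fun_lty.
have split_I : I = ((x `^ p)%:E * mu setT +
    \int[mu]_t (1 * (W t `^ p - x `^ p))%:E)%E.
  rewrite -integral_cst// -ge0_integralD//.
  - by apply: eq_integral => t _; rewrite /= -EFinD mul1r addrC subrK.
  - by move=> t _; rewrite lee_fin powR_ge0.
  - move=> t _; rewrite lee_fin mul1r subr_ge0.
    by rewrite ge0_ler_powR ?nnegrE// ltW.
  - by apply/measurable_EFinP; under eq_fun do rewrite mul1r;
      exact: measurable_funB.
have weak_int : (\int[mu]_t (1 * (W t `^ p - x `^ p))%:E <=
    q%:E * \int[mu]_t (V t * (W t `^ (p - 1) - x `^ (p - 1)))%:E)%E.
  rewrite !layer_cake//.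
  rewrite -ge0_integralZl//; last 3 first.
  - apply: emeasurable_funM.
      apply/measurable_EFinP; apply: measurable_funM => //.
      exact: measurable_funTS.
    apply: measurable_funTS; exact: measurable_integral_superlevel.
  - move=> l _; rewrite mule_ge0//.
      by rewrite lee_fin mulr_ge0 ?powR_ge0// ltW.
    by apply: integral_ge0 => t _; rewrite lee_fin.
  - by rewrite lee_fin ltW.
  apply: ge0_le_integral => //.
  - move=> l _; rewrite mule_ge0//.
      by rewrite lee_fin mulr_ge0 ?powR_ge0// ltW.
    by apply: integral_ge0 => t _; rewrite lee_fin.
  - apply: emeasurable_funM.
      apply/measurable_EFinP; apply: measurable_funM => //.
      exact: measurable_funTS.
    by apply: measurable_funTS; apply: measurable_integral_superlevel.
  - apply: emeasurable_funM => //; apply: emeasurable_funM.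
      apply/measurable_EFinP; apply: measurable_funM => //.
      exact: measurable_funTS.
    apply: measurable_funTS; exact: measurable_integral_superlevel.
  move=> l; rewrite /= in_itv/= andbT => xl.
  have l0 : 0 < l by exact: lt_trans xl.
  rewrite integral_cst// mul1e.
  have -> : p * l `^ (p - 1) = q * ((p - 1) * l `^ (p - 1 - 1)) * l.
    rewrite -(mulr_powRB1 (ltW l0) p10) /q; field.
    by rewrite gt_eqF.
  rewrite !EFinM -!muleA.
  do 4 (apply: lee_wpmul2l; first by rewrite lee_fin ?powR_ge0 ?invr_ge0// ltW).
  exact: weak.
have young : (q%:E * \int[mu]_t (V t * (W t `^ (p - 1) - x `^ (p - 1)))%:E <=
    (p^-1 * q `^ p)%:E * \int[mu]_t (V t `^ p)%:E + (q^-1)%:E * I)%E.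
  rewrite -!ge0_integralZl//; last 9 first.
  all: try by rewrite lee_fin ?mulr_ge0 ?powR_ge0 ?invr_ge0// ltW.
  all: try by move=> t _; rewrite lee_fin powR_ge0.
  all: try exact/measurable_EFinP.
  - apply/measurable_EFinP; apply: measurable_funM => //.
    exact: measurable_funB.
  - move=> t _; rewrite lee_fin mulr_ge0// subr_ge0.
    by rewrite ge0_ler_powR ?nnegrE// ltW.
  rewrite -ge0_integralD//; last 4 first.
  - by move=> t _; rewrite lee_fin !mulr_ge0 ?invr_ge0 ?powR_ge0// ltW.
  - by apply/measurable_EFinP; exact: measurable_funM.
  - by move=> t _; rewrite lee_fin mulr_ge0 ?invr_ge0 ?powR_ge0// ltW.
  - by apply/measurable_EFinP; exact: measurable_funM.
  apply: ge0_le_integral => //.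
  - move=> t _; rewrite lee_fin mulr_ge0 ?(ltW q0)// mulr_ge0// subr_ge0.
    by rewrite ge0_ler_powR ?nnegrE// ltW.
  - apply/measurable_EFinP; apply: measurable_funM => //.
    by apply: measurable_funM => //; exact: measurable_funB.
  - by apply/measurable_EFinP; apply: measurable_funD; exact: measurable_funM.
  move=> t _; rewrite -EFinD lee_fin.
  apply: (@le_trans _ _ ((q * V t) * W t `^ (p - 1))).
    rewrite -mulrA ler_wpM2l ?(ltW q0)// ler_wpM2l// gerBl powR_ge0//.
  have := @conjugate_powR _ (q * V t) (W t `^ (p - 1)) p q.
  rewrite mulr_ge0 ?(ltW q0)// powR_ge0 => /(_ isT isT p0 q0).
  have -> : p^-1 + q^-1 = 1 by rewrite /q; field; rewrite !gt_eqF.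
  move=> /(_ erefl) /le_trans; apply.
  rewrite powRM ?(ltW q0)// -powRrM.
  have -> : (p - 1) * q = p by rewrite /q; field; rewrite gt_eqF.
  by rewrite mulrC mulrA [_ / q]mulrC.
have [->|Vfin] := eqVneq (\int[mu]_t (V t `^ p)%:E)%E +oo%E.
  rewrite gt0_muley ?lte_fin ?powR_gt0// addey ?leey//.
  rewrite gt_eqF// (@lt_le_trans _ _ 0%E) ?ltNyr// mule_ge0// lee_fin.
  by rewrite mulr_ge0 ?powR_ge0 ?(ltW p0).
have {}Vfin : (\int[mu]_t (V t `^ p)%:E)%E \is a fin_num.
  rewrite ge0_fin_numE ?lt_neqAle ?Vfin ?leey//.
  by apply: integral_ge0 => t _; rewrite lee_fin powR_ge0.
have mufin : mu setT \is a fin_num by exact: fin_num_measure.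
have := leeD2l ((x `^ p)%:E * mu setT)%E (le_trans weak_int young).
rewrite -split_I.
move: Ifin Vfin mufin; case: (I) => // i _; case: (\int[mu]_t _)%E => // v _.
case: (mu setT) => // m _; rewrite -!EFinM -!EFinD !lee_fin.
have -> : q^-1 = 1 - p^-1 by rewrite /q; field; rewrite !gt_eqF.
move=> H.
have : p^-1 * i <= x `^ p * m + p^-1 * q `^ p * v by lra.
rewrite -(ler_pM2l p0) !mulrA divff ?gt_eqF// mul1r => /le_trans; apply.
by rewrite mulrDr !mulrA divff ?gt_eqF// mul1r.
Qed.
End StrongType.

Section MaximalToLp.
Context {R : realType} {d} {T : measurableType d}.
Context (mu : {finite_measure set T -> \bar R}).

(** Truncate: the functions [max (1/(n+1)) (min U (n+1))] inherit the weak
    inequality for [l > 1/(n+1)], and the error term of the bounded case tends to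
    [0] with [n]. *)
Lemma strong_of_weak (U : T -> \bar R) (V : T -> R) (p : R) : 1 < p ->
  measurable_fun setT U -> measurable_fun setT V ->
  (forall t, (0 <= U t)%E) -> (forall t, 0 <= V t) ->
  (forall l, 0 < l -> (l%:E * mu [set t | (l%:E < U t)] <=
    \int[mu]_(t in [set t | (l%:E < U t)]) (V t)%:E)%E) ->
  (\int[mu]_t (U t `^ p) <=
    ((p / (p - 1)) `^ p)%:E * \int[mu]_t (V t `^ p)%:E)%E.
Proof.
move=> p1 mU mV U0 V0 weak.
have p0 : 0 < p by exact: lt_trans p1.
pose N n : R := n.+1%:R.
have N0 n : 0 < N n by rewrite ltr0n.
have N1 n : 1 <= N n by rewrite ler1n.
pose Un n t := fine (mine (U t) (N n)%:E).
have UnE n t : (Un n t)%:E = mine (U t) (N n)%:E.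
  rewrite fineK// ge0_fin_numE; first by rewrite gt_min ltry orbT.
  by rewrite le_min U0 lee_fin ltW.
have mUn n : measurable_fun setT (Un n).
  apply/measurable_EFinP.
  rewrite (_ : _ \o _ = fun t => mine (U t) (N n)%:E); last first.
    by apply/funext => t; exact: UnE.
  exact: measurable_mine.
have Un0 n t : 0 <= Un n t by rewrite -lee_fin UnE le_min U0 lee_fin ltW.
have UnN n t : Un n t <= N n by rewrite -lee_fin UnE ge_min lexx orbT.
have mUnp n : measurable_fun setT (fun t => Un n t `^ p).
  exact: (measurableT_comp (measurable_powR p) (mUn n)).
have step n : (\int[mu]_t (Un n t `^ p)%:E <= (p * (N n)^-1)%:E * mu setT +
    ((p / (p - 1)) `^ p)%:E * \int[mu]_t (V t `^ p)%:E)%E.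
  pose W t := Num.max (N n)^-1 (Un n t).
  have mW : measurable_fun setT W by exact: measurable_maxr.
  apply: (@le_trans _ _ (\int[mu]_t (W t `^ p)%:E)%E).
    apply: ge0_le_integral => //.
    - by move=> t _; rewrite lee_fin powR_ge0.
    - exact/measurable_EFinP.
    - by apply/measurable_EFinP; exact: (measurableT_comp (measurable_powR p) mW).
    - move=> t _; rewrite lee_fin ge0_ler_powR ?nnegrE ?(ltW p0)//.
      + by rewrite le_max Un0 orbT.
      + by rewrite le_max lexx orbT.
  apply: (@le_trans _ _ ((p * (N n)^-1 `^ p)%:E * mu setT +
      ((p / (p - 1)) `^ p)%:E * \int[mu]_t (V t `^ p)%:E)%E); last first.
    rewrite leeD2r// lee_wpmul2r// lee_fin ler_wpM2l ?(ltW p0)//.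
    apply: ge1r_powR; last exact: ltW.
    by rewrite invr_gt0 N0 invf_le1 ?N0 ?N1.
  apply: (@strong_of_weak_bounded _ _ _ mu W V p _ (N n)) => //.
  - by rewrite invr_gt0.
  - move=> t; rewrite le_max lexx/= ge_max UnN andbT.
    by apply: le_trans (N1 n); rewrite invf_le1 ?N0 ?N1.
  - move=> l xl; have l0 : 0 < l by rewrite (lt_trans _ xl)// invr_gt0.
    have -> : [set t | l < W t] = if l < N n then [set t | (l%:E < U t)%E] else set0.
      case: ifPn => lN; apply/seteqP; split=> t //=.
      + by rewrite lt_max ltNge (ltW xl)/= -lte_fin UnE lt_min => /andP[].
      + move=> lU; rewrite lt_max -(lte_fin l (Un _ _)) UnE lt_min lU lte_fin lN.
        by rewrite orbT.
      + rewrite lt_max ltNge (ltW xl)/= -lte_fin UnE lt_min lte_fin (negbTE lN).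
        by rewrite andbF.
    by case: ifPn => _; [exact: weak|rewrite measure0 mule0 integral_set0].
have cvL : (\int[mu]_t (Un n t `^ p)%:E)%E @[n --> \oo] -->
    (\int[mu]_t (U t `^ p))%E.
  have -> : (\int[mu]_t (U t `^ p) =
      \int[mu]_t (limn (fun n => (Un n t `^ p)%:E)))%E.
    apply: eq_integral => t _; apply/esym/cvg_lim => //.
    have [Uy|Uy] := eqVneq (U t) +oo%E.
      rewrite Uy poweRyr ?gt_eqF//.
      have cN : (N n)%:E @[n --> \oo] --> +oo%E.
        apply/cvgeryP; apply/cvgryPge => A.
        apply: filterS (nbhs_infty_ger A) => n /le_trans; apply.
        by rewrite ler_nat.
      apply: gee_cvgy cN; apply: nearW => n.
      rewrite lee_fin.
      have -> : Un n t = N n by apply: EFin_inj; rewrite UnE Uy minye.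
      by rewrite le1r_powR// ltW.
    have Ufin : U t \is a fin_num by rewrite ge0_fin_numE// lt_neqAle Uy leey.
    apply: cvg_near_cst.
    have := nbhs_infty_ger (fine (U t)).
    apply: filterS => n Un_le; rewrite -poweR_EFin UnE.
    congr (_ `^ _)%E; apply/min_idPl; rewrite -(fineK Ufin) lee_fin.
    by rewrite (le_trans Un_le)// ler_nat.
  apply: cvg_monotone_convergence => //.
  - by move=> n; exact/measurable_EFinP.
  - by move=> n t _; rewrite lee_fin powR_ge0.
  - move=> t _ m n mn; rewrite lee_fin ge0_ler_powR ?nnegrE ?(ltW p0)//.
    rewrite -lee_fin !UnE le_min ge_min lexx/= ge_min lee_fin ler_nat ltnS mn.
    by rewrite orbT.
have cvR : ((p * (N n)^-1)%:E * mu setT +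
    ((p / (p - 1)) `^ p)%:E * \int[mu]_t (V t `^ p)%:E)%E @[n --> \oo] -->
    (((p / (p - 1)) `^ p)%:E * \int[mu]_t (V t `^ p)%:E)%E.
  rewrite -[X in _ --> X]add0e; apply: cvgeD => //.
  - rewrite -(fineK (fin_num_measure mu setT measurableT)).
    under eq_fun do rewrite -EFinM mulrAC; apply: cvg_EFin => //.
      exact: nearW.
    rewrite -[X in _ --> X](mulr0 (p * fine (mu setT))).
    by apply: cvgMr; exact: cvg_harmonic.
  - exact: cvg_cst.
by apply: lee_cvg_to cvL cvR _; exact: nearW.
Qed.

(** Multiply the weak inequality by [l^(p-1)] and bound [V l^(p-1)] on the
    superlevel set by [V^p / p + l^p / q]; the term in [l^p] is absorbed. *)
Lemma weak_Lp_of_weak (U : T -> \bar R) (V : T -> R) (p l : R) : 1 < p -> 0 < l ->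
  measurable_fun setT U -> measurable_fun setT V -> (forall t, 0 <= V t) ->
  (l%:E * mu [set t | (l%:E < U t)] <=
    \int[mu]_(t in [set t | (l%:E < U t)]) (V t)%:E)%E ->
  ((l `^ p)%:E * mu [set t | (l%:E < U t)] <= \int[mu]_t (V t `^ p)%:E)%E.
Proof.
move=> p1 l0 mU mV V0.
set B := [set t | _].
have mB : measurable B.
  rewrite -[B]setTI; exact: (measurable_lte measurableT (measurable_cst _) mU).
have p0 : 0 < p by exact: lt_trans p1.
have p10 : 0 < p - 1 by rewrite subr_gt0.
set q := p / (p - 1).
have q0 : 0 < q by rewrite divr_gt0.
have mVp : measurable_fun setT (fun t => V t `^ p).
  exact: (measurableT_comp (measurable_powR p) mV).
have lp0 : (0 <= (l `^ (p - 1))%:E)%E by rewrite lee_fin powR_ge0.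
move=> /(lee_wpmul2l lp0).
rewrite muleA -EFinM mulrC mulr_powRB1 ?(ltW l0)// => weak.
have young : ((l `^ (p - 1))%:E * \int[mu]_(t in B) (V t)%:E <=
    (p^-1)%:E * \int[mu]_t (V t `^ p)%:E + (q^-1 * l `^ p)%:E * mu B)%E.
  apply: (@le_trans _ _ ((p^-1)%:E * \int[mu]_(t in B) (V t `^ p)%:E +
      (q^-1 * l `^ p)%:E * mu B)%E); last first.
    rewrite leeD2r// lee_wpmul2l ?lee_fin ?invr_ge0 ?(ltW p0)//.
    apply: ge0_subset_integral => //; first exact/measurable_EFinP.
    by move=> t _; rewrite lee_fin powR_ge0.
  rewrite -(integral_cst mu mB) -!ge0_integralZl//; last 5 first.
  all: try by rewrite lee_fin ?mulr_ge0 ?powR_ge0 ?invr_ge0// ltW.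
  all: try by move=> t _; rewrite lee_fin ?powR_ge0.
  all: try by apply/measurable_EFinP; exact: measurable_funTS.
  rewrite -ge0_integralD//; last 3 first.
  all: try by move=> t _; rewrite lee_fin !mulr_ge0 ?invr_ge0 ?powR_ge0// ltW.
  all: try by apply/measurable_EFinP; apply: measurable_funM => //;
    exact: measurable_funTS.
  apply: ge0_le_integral => //.
  all: try by move=> t _; rewrite lee_fin !mulr_ge0 ?invr_ge0 ?powR_ge0// ltW.
  all: try by apply/measurable_EFinP; apply: measurable_funM => //;
    exact: measurable_funTS.
  - apply/measurable_EFinP; apply: measurable_funD => //.
    by apply: measurable_funM => //; exact: measurable_funTS.
  move=> t _; rewrite -!EFinM -EFinD lee_fin.
  have := @conjugate_powR _ (V t) (l `^ (p - 1)) p q.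
  rewrite V0 powR_ge0 => /(_ isT isT p0 q0).
  have -> : p^-1 + q^-1 = 1 by rewrite /q; field; rewrite !gt_eqF.
  rewrite mulrC; move=> /(_ erefl) /le_trans; apply.
  rewrite -powRrM.
  have -> : (p - 1) * q = p by rewrite /q; field; rewrite gt_eqF.
  by rewrite mulrC [_ / q]mulrC.
have [->|Vfin] := eqVneq (\int[mu]_t (V t `^ p)%:E)%E +oo%E; first by rewrite leey.
have {}Vfin : (\int[mu]_t (V t `^ p)%:E)%E \is a fin_num.
  rewrite ge0_fin_numE ?lt_neqAle ?Vfin ?leey//.
  by apply: integral_ge0 => t _; rewrite lee_fin powR_ge0.
have mufin : mu B \is a fin_num by exact: fin_num_measure.
have := le_trans weak young.
move: Vfin mufin; case: (\int[mu]_t _)%E => // v _.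
case: (mu B) => // m _; rewrite -!EFinM -!EFinD !lee_fin.
have -> : q^-1 = 1 - p^-1 by rewrite /q; field; rewrite !gt_eqF.
move=> H; rewrite -(ler_pM2l (_ : 0 < p^-1)) ?invr_gt0//.
by move: H; set a := p^-1; set b := l `^ p; nra.
Qed.

(** [{U >= eps}] is contained in [{U > l}] for every [l < eps]; let [l] tend to
    [eps]. *)
Lemma weak_Lp_of_weak_ge (U : T -> \bar R) (V : T -> R) (p eps : R) :
  1 < p -> 0 < eps ->
  measurable_fun setT U -> measurable_fun setT V -> (forall t, 0 <= V t) ->
  (forall l, 0 < l -> (l%:E * mu [set t | (l%:E < U t)] <=
    \int[mu]_(t in [set t | (l%:E < U t)]) (V t)%:E)%E) ->
  ((eps `^ p)%:E * mu [set t | (eps%:E <= U t)] <= \int[mu]_t (V t `^ p)%:E)%E.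
Proof.
move=> p1 e0 mU mV V0 weak.
have p0 : 0 < p by exact: lt_trans p1.
have mlt l : measurable [set t | (l%:E < U t)%E].
  rewrite -[X in measurable X]setTI.
  exact: (measurable_lte measurableT (measurable_cst _) mU).
have mle l : measurable [set t | (l%:E <= U t)%E].
  rewrite -[X in measurable X]setTI.
  exact: (measurable_lee measurableT (measurable_cst _) mU).
have below l : 0 < l -> l < eps ->
    ((l `^ p)%:E * mu [set t | (eps%:E <= U t)%E] <= \int[mu]_t (V t `^ p)%:E)%E.
  move=> l0 le; apply: le_trans (weak_Lp_of_weak p1 l0 mU mV V0 (weak _ l0)).
  rewrite lee_wpmul2l ?lee_fin ?powR_ge0// le_measure ?inE// => t /=.
  by apply: lt_le_trans; rewrite lte_fin.
have [->|Vfin] := eqVneq (\int[mu]_t (V t `^ p)%:E)%E +oo%E; first by rewrite leey.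
have V0' : (0 <= \int[mu]_t (V t `^ p)%:E)%E.
  by apply: integral_ge0 => t _; rewrite lee_fin powR_ge0.
have {}Vfin : (\int[mu]_t (V t `^ p)%:E)%E \is a fin_num.
  by rewrite ge0_fin_numE ?lt_neqAle ?Vfin ?leey.
have mufin : mu [set t | (eps%:E <= U t)%E] \is a fin_num by exact: fin_num_measure.
have m0 : (0 <= mu [set t | (eps%:E <= U t)%E])%E by exact: measure_ge0.
move: Vfin mufin below V0' m0; case: (\int[mu]_t _)%E => // v _.
case: (mu _) => // m _ below; rewrite -EFinM !lee_fin => v0 m0.
rewrite leNgt; apply/negP => vlt.
have {}m0 : 0 < m.
  rewrite lt_neqAle m0 andbT; apply/eqP => m0'.
  by move: vlt; rewrite -m0' mulr0 ltNge v0.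
(* [c] solves [c^p m = v], so the bound fails at any level in (c, eps) *)
pose c := (v / m) `^ p^-1.
have c0 : 0 <= c by exact: powR_ge0.
have cp : c `^ p = v / m.
  by rewrite /c -powRrM mulVf ?gt_eqF// powRr1// divr_ge0// ltW.
have ce : c < eps.
  rewrite ltNge; apply/negP => ec.
  have : eps `^ p <= c `^ p by rewrite ge0_ler_powR ?nnegrE// ltW.
  by rewrite cp ler_pdivlMr// leNgt vlt.
have h0 : 0 < (c + eps) / 2 by lra.
have he : (c + eps) / 2 < eps by lra.
have := below _ h0 he; rewrite -EFinM lee_fin -ler_pdivlMr// -cp leNgt.
by rewrite gt0_ltr_powR ?nnegrE ?(ltW h0)//; lra.
Qed.
End MaximalToLp.

(** * Simple and strongly measurable functions *)

Section FinitelyValued.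
Context {Omega : pointedType} (G : set (set Omega)).
Hypothesis G_sigma : sigma_algebra setT G.

Lemma sub_sigma_bigcup_fin {I : Type} (D : set I) (A : I -> set Omega) :
  finite_set D -> (forall i, D i -> G (A i)) -> G (\bigcup_(i in D) A i).
Proof.
rewrite -(measurable_g_measurableTypeE G_sigma).
exact: (@fin_bigcup_measurable _ (g_sigma_algebraType G)).
Qed.

Lemma sub_sigmaI (A B : set Omega) : G A -> G B -> G (A `&` B).
Proof.
rewrite -(measurable_g_measurableTypeE G_sigma).
exact: (@measurableI _ (g_sigma_algebraType G)).
Qed.

Lemma sub_sigmaD (A B : set Omega) : G A -> G B -> G (A `\` B).
Proof.
rewrite -(measurable_g_measurableTypeE G_sigma).
exact: (@measurableD _ (g_sigma_algebraType G)).
Qed.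

(** The notion of simple function with an arbitrary target: pairing two simple
    functions brings them to a common partition, but the pair does not take
    values in a Banach space of the given kind. *)
Definition finitely_valued {Y : Type} (u : Omega -> Y) : Prop :=
  finite_set (range u) /\ forall y, G (u @^-1` [set y]).

Lemma finitely_valued_preimage {Y : Type} (u : Omega -> Y) (B : set Y) :
  finitely_valued u -> G (u @^-1` B).
Proof.
move=> [fu Gu].
have -> : u @^-1` B = \bigcup_(y in range u `&` B) u @^-1` [set y].
  apply/seteqP; split=> [w Bw|w [y [_ By] /= ->]//].
  by exists (u w) => //; split=> //; exists w.
by apply: sub_sigma_bigcup_fin => // ; exact: sub_finite_set fu.
Qed.

Lemma finitely_valued_comp {Y Z : Type} (u : Omega -> Y) (phi : Y -> Z) :
  finitely_valued u -> finitely_valued (phi \o u).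
Proof.
move=> uP; split; last first.
  by move=> z; exact: (finitely_valued_preimage (phi @^-1` [set z])).
by rewrite -(image_comp u phi); apply: finite_image; exact: uP.1.
Qed.

Lemma finitely_valued_pair {Y Z : Type} (u : Omega -> Y) (v : Omega -> Z) :
  finitely_valued u -> finitely_valued v ->
  finitely_valued (fun w => (u w, v w)).
Proof.
move=> [fu Gu] [fv Gv]; split.
  apply: sub_finite_set (finite_setX fu fv).
  by move=> _ [w _ <-]; split; exists w.
move=> [y z].
have -> : (fun w => (u w, v w)) @^-1` [set (y, z)] =
    u @^-1` [set y] `&` v @^-1` [set z].
  by apply/seteqP; split=> w /= [<- <-].
exact: sub_sigmaI.
Qed.

Lemma finitely_valued_cst {Y : Type} (y : Y) : finitely_valued (fun=> y).
Proof.
split; first by apply: sub_finite_set (finite_set1 y) => _ [w _ <-].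
move=> z; rewrite -(measurable_g_measurableTypeE G_sigma) preimage_cst.
by case: ifPn => _; [exact: measurableT|exact: measurable0].
Qed.

Lemma finitely_valued_restrict {Y : Type} (u v : Omega -> Y) (B : set Omega) :
  G B -> finitely_valued u -> finitely_valued v ->
  finitely_valued (fun w => if w \in B then u w else v w).
Proof.
move=> GB fu fv.
have fB : finitely_valued (fun w => w \in B).
  split; first exact: (sub_finite_set (@subsetT _ _)).
  have GBC : G (~` B) by case: G_sigma => _ + _ => /(_ _ GB); rewrite setTD.
  case.
    have -> // : (fun w => w \in B) @^-1` [set true] = B.
    by apply/seteqP; split=> w /= => [/set_mem|/mem_set].
  have -> // : (fun w => w \in B) @^-1` [set false] = ~` B.
  apply/seteqP; split=> w /=; first by move/negbT; rewrite notin_setE.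
  by move=> Bw; apply/negbTE; rewrite notin_setE.
exact: (finitely_valued_comp (fun z => if z.1 then z.2.1 else z.2.2)
  (finitely_valued_pair fB (finitely_valued_pair fu fv))).
Qed.

End FinitelyValued.

Section StronglyMeasurable.
Context {d} {Omega : measurableType d} {R : realType}.
Implicit Types X Y Z : completeNormedModType R.

Lemma strongly_measurable_cst X (G : set (set Omega)) (x : X) :
  sigma_algebra setT G -> strongly_measurable G (fun=> x).
Proof.
move=> sG; exists (fun=> fun=> x); split; last by move=> w; exact: cvg_cst.
by move=> n; exact: finitely_valued_cst.
Qed.

Lemma strongly_measurable_comp2 X Y Z (G : set (set Omega))
    (phi : X * Y -> Z) (f : Omega -> X) (g : Omega -> Y) :
  sigma_algebra setT G -> continuous phi ->
  strongly_measurable G f -> strongly_measurable G g ->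
  strongly_measurable G (fun w => phi (f w, g w)).
Proof.
move=> sG cphi [s [Gs sf]] [t [Gt tg]].
exists (fun n w => phi (s n w, t n w)); split.
  move=> n; apply: (finitely_valued_comp sG phi).
  exact: (finitely_valued_pair sG (Gs n) (Gt n)).
move=> w.
apply: (@cvg_comp _ _ _ (fun n => (s n w, t n w)) phi _ (nbhs (f w, g w))).
  exact: cvg_pair.
exact: cphi.
Qed.

(** Passing to the measurable type generated by [G] makes the theory of real
    measurable functions available for a sub-sigma-algebra. *)
Lemma strongly_measurable_norm X (G : set (set Omega)) (f : Omega -> X) :
  sigma_algebra setT G -> strongly_measurable G f ->
  measurable_fun (setT : set (g_sigma_algebraType G)) (fun w => `|f w|).
Proof.
move=> sG [s [Gs sf]].
apply: (@measurable_fun_cvg _ (g_sigma_algebraType G) _ _ (fun n w => `|s n w|)).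
  move=> n _ B _; rewrite setTI measurable_g_measurableTypeE//.
  apply: (finitely_valued_preimage sG).
  exact: (finitely_valued_comp sG (fun x : X => `|x|) (Gs n)).
by move=> w _; apply: cvg_norm.
Qed.

Lemma strongly_measurable_normT X (f : Omega -> X) :
  strongly_measurable measurable f -> measurable_fun setT (fun w => `|f w|).
Proof.
move=> /(strongly_measurable_norm (sigma_algebra_measurable _)).
move=> mf _ B mB; have := mf measurableT B mB.
by rewrite measurable_g_measurableTypeE//; exact: sigma_algebra_measurable.
Qed.

Lemma strongly_measurableS X (G H : set (set Omega)) (f : Omega -> X) :
  G `<=` H -> strongly_measurable G f -> strongly_measurable H f.
Proof.
move=> GH [s [Gs sf]]; exists s; split=> // n.
by case: (Gs n) => ? Gx; split=> // x; exact/GH.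
Qed.

Lemma strongly_measurableZD X (G : set (set Omega)) (a : R) (f g : Omega -> X) :
  sigma_algebra setT G -> strongly_measurable G f -> strongly_measurable G g ->
  strongly_measurable G (fun w => a *: f w + g w).
Proof.
move=> sG mf mg.
apply: (@strongly_measurable_comp2 X X X G (fun z => a *: z.1 + z.2) f g) => //.
move=> z; apply: cvgD; last exact: cvg_snd.
by apply: cvgZr; exact: cvg_fst.
Qed.

Lemma strongly_measurableB X (G : set (set Omega)) (f g : Omega -> X) :
  sigma_algebra setT G -> strongly_measurable G f -> strongly_measurable G g ->
  strongly_measurable G (fun w => f w - g w).
Proof.
move=> sG mf mg.
apply: (@strongly_measurable_comp2 X X X G (fun z => z.1 - z.2) f g) => //.
by move=> z; apply: cvgB; [exact: cvg_fst|exact: cvg_snd].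
Qed.

Lemma simple_strongly_measurable X (G : set (set Omega)) (s : Omega -> X) :
  simple G s -> strongly_measurable G s.
Proof. by move=> Gs; exists (fun=> s); split=> // w; exact: cvg_cst. Qed.

End StronglyMeasurable.

(** * The Bochner integral and conditional expectation *)

Section Bochner.
Context {d} {Omega : measurableType d} {R : realType}.
Context (mu : {finite_measure set Omega -> \bar R}).
Implicit Types X : completeNormedModType R.

Local Notation sigmaT := (sigma_algebra_measurable Omega).
Local Notation values u := (finmap.enum_fset (fset_set (range u))).

Lemma ge0_integral_fibers {Y : choiceType} (u : Omega -> Y) (A : set Omega)
    (k : Omega -> \bar R) :
  finitely_valued measurable u -> measurable A ->
  measurable_fun setT k -> (forall w, (0 <= k w)%E) ->
  (\int[mu]_(w in A) k w =
   \sum_(y <- values u) \int[mu]_(w in A `&` u @^-1` [set y]) k w)%E.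
Proof.
move=> [fu mu_] mA mk k0.
have AE : A = \big[setU/set0]_(y <- values u) (A `&` u @^-1` [set y]).
  rewrite bigsetU_fset_set//; apply/seteqP; split=> [w Aw|w [y _ []]//].
  by exists (u w) => //; exists w.
rewrite {1}AE ge0_integral_bigsetU//.
- by move=> y; apply: measurableI.
- by move=> y z _ _ [w [[_ /= <-] [_ /= <-]]].
- exact: measurable_funTS.
Qed.

Lemma measure_fibers {Y : choiceType} (u : Omega -> Y) (A : set Omega) :
  finitely_valued measurable u -> measurable A ->
  fine (mu A) = \sum_(y <- values u) fine (mu (A `&` u @^-1` [set y])).
Proof.
move=> uP mA.
have := @ge0_integral_fibers _ u A (cst 1%E) uP mA (measurable_cst _) (fun=> lee01).
rewrite integral_cst// mul1e => ->.
have mAy y : measurable (A `&` u @^-1` [set y]).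
  by apply: measurableI => //; exact: uP.2.
rewrite sum_fine; last by move=> y _; exact: fin_num_measure.
by congr fine; apply: eq_bigr => y _; rewrite integral_cst// mul1e.
Qed.

(** The integral of a simple function may be computed on any finer finite
    partition; linearity follows by taking [u] to be a pair of simple
    functions. *)
Lemma simple_integral_comp X {Y : choiceType} (u : Omega -> Y) (phi : Y -> X)
    (A : set Omega) :
  finitely_valued measurable u -> measurable A ->
  simple_integral mu A (phi \o u) =
  \sum_(y <- values u) fine (mu (A `&` u @^-1` [set y])) *: phi y.
Proof.
move=> uP mA; have fu := uP.1.
have [fpu mpu] := finitely_valued_comp sigmaT phi uP.
rewrite /simple_integral fsbig_finite//=.
(* group the values [y] of [u] by their image [x] under [phi] *)
transitivity (\sum_(x <- values (phi \o u)) \sum_(y <- values u | x == phi y)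
    fine (mu (A `&` u @^-1` [set y])) *: phi y).
  apply: eq_bigr => x _; rewrite (measure_fibers uP); last exact: measurableI.
  rewrite scaler_suml [RHS]big_mkcond/=; apply: eq_bigr => y _.
  case: eqP => [->|xy].
    congr (fine (mu _) *: _); apply/seteqP; split=> [w [[? _] ?]//|w [Aw /= uy]].
    by split=> //; split=> //=; rewrite uy.
  rewrite (_ : _ `&` _ = set0) ?measure0 ?scale0r//.
  by apply/seteqP; split=> // w [[_ /= ux] /= uy]; apply: xy; rewrite -ux -uy.
rewrite (exchange_big_dep xpredT)//= big_seq [RHS]big_seq.
apply: eq_bigr => y; rewrite in_fset_set// inE => -[w _ <-].
rewrite -big_filter filter_pred1_uniq ?big_seq1 ?finmap.fset_uniq//.
by rewrite in_fset_set// inE; exists w.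
Qed.

Lemma simple_integralB X (A : set Omega) (s t : Omega -> X) :
  simple measurable s -> simple measurable t -> measurable A ->
  simple_integral mu A s - simple_integral mu A t =
  simple_integral mu A (fun w => s w - t w).
Proof.
move=> ms mt mA; have stP := finitely_valued_pair sigmaT ms mt.
have := simple_integral_comp (fun z => z.1) stP mA.
have := simple_integral_comp (fun z => z.2) stP mA.
have := simple_integral_comp (fun z => z.1 - z.2) stP mA.
rewrite /comp/= => -> -> ->; rewrite -sumrB; apply: eq_bigr => y _.
by rewrite scalerBr.
Qed.

Lemma integral_norm_fibers X {Y : choiceType} (u : Omega -> Y) (phi : Y -> X)
    (A : set Omega) : finitely_valued measurable u -> measurable A ->
  (\int[mu]_(w in A) (`|phi (u w)|)%:E =
   (\sum_(y <- values u) fine (mu (A `&` u @^-1` [set y])) * `|phi y|)%:E)%E.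
Proof.
move=> uP mA.
rewrite (ge0_integral_fibers uP mA)//; last first.
  apply/measurable_EFinP/strongly_measurable_normT.
  exact/simple_strongly_measurable/(finitely_valued_comp sigmaT).
rewrite -sumEFin; apply: eq_bigr => y _.
have mAy : measurable (A `&` u @^-1` [set y]) by apply: measurableI => //; case: uP.
transitivity (\int[mu]_(w in A `&` u @^-1` [set y]) cst (`|phi y|%:E) w)%E.
  by apply: eq_integral => w; rewrite inE => -[_ /= ->].
by rewrite integral_cst// EFinM fineK ?fin_num_measure// muleC.
Qed.

Lemma le_norm_simple_integral X (A : set Omega) (s : Omega -> X) :
  simple measurable s -> measurable A ->
  (`|simple_integral mu A s|%:E <= \int[mu]_(w in A) (`|s w|)%:E)%E.
Proof.
move=> ms mA.
rewrite (@integral_norm_fibers X X s id A ms mA) lee_fin.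
have -> := simple_integral_comp id ms mA.
apply: le_trans (ler_norm_sum _ _ _) _; apply: ler_sum => y _.
by rewrite normrZ ger0_norm// fine_ge0.
Qed.

Lemma simple_integral_cst X (A : set Omega) (x : X) : measurable A ->
  simple_integral mu A (fun=> x) = fine (mu A) *: x.
Proof.
move=> mA.
have uP : finitely_valued measurable (fun _ : Omega => tt).
  exact: (finitely_valued_cst sigmaT).
have := simple_integral_comp (fun=> x) uP mA; rewrite /comp => ->.
by rewrite -scaler_suml -measure_fibers.
Qed.

End Bochner.

#[local] Hint Extern 0 (sigma_algebra _ _) =>
  solve [exact: sigma_algebra_measurable] : core.

Section BochnerIntegral.
Context {d} {Omega : measurableType d} {R : realType}.
Context (mu : {finite_measure set Omega -> \bar R}).
Context {X : completeNormedModType R}.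
Implicit Types (f g s t : Omega -> X) (A : set Omega).

Local Notation sigmaT := (sigma_algebra_measurable Omega).

Lemma measurable_normB f g :
  strongly_measurable measurable f -> strongly_measurable measurable g ->
  measurable_fun setT (fun w => (`|f w - g w|)%:E).
Proof.
move=> mf mg; apply/measurable_EFinP/strongly_measurable_normT.
exact: strongly_measurableB.
Qed.

Lemma Lp1P f : Lp mu 1 f <->
  strongly_measurable measurable f /\
  mu.-integrable setT (fun w => (`|f w|)%:E).
Proof.
have E : Lpnorm mu 1 f = (\int[mu]_w `|(`|f w|)%:E|)%E by exact: Lnorm1.
rewrite /Lp /= E; split=> -[mf If]; split=> //.
  apply/integrableP; split=> //.
  exact/measurable_EFinP/strongly_measurable_normT.
by case/integrableP: If.
Qed.

(** Replacing [s n w] by [0] wherever [|s n w| > 2 |g w|] keeps the approximants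
    [G]-simple and pointwise convergent, and makes them dominated by [2 |g|], so
    that dominated convergence applies. *)
Lemma simple_approximation (G : set (set Omega)) g :
  sigma_algebra setT G -> G `<=` measurable ->
  strongly_measurable G g -> Lp mu 1 g ->
  exists s : (Omega -> X)^nat, (forall n, simple G (s n)) /\
    (\int[mu]_w (`|g w - s n w|)%:E)%E @[n --> \oo] --> 0%E.
Proof.
move=> sG GT mg /Lp1P[_ Ig].
have [s [Gs sg]] := mg.
pose B n := [set w | 2 * `|g w| < `|s n w|].
have GB n : G (B n).
  rewrite -(measurable_g_measurableTypeE sG).
  apply: (@measurable_ltr_set _ _ (g_sigma_algebraType G)).
    by apply: measurable_funM => //; exact: strongly_measurable_norm.
  apply: strongly_measurable_norm => //.
  exact: simple_strongly_measurable.
pose s' n w := if w \in B n then 0 else s n w.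
have Gs' n : simple G (s' n).
  exact: (finitely_valued_restrict sG (GB n) (finitely_valued_cst sG _) (Gs n)).
exists s'; split=> //.
have bnd n w : `|g w - s' n w| <= 3 * `|g w|.
  have := normr_ge0 (g w).
  rewrite /s'; case: ifPn => [_|]; first by rewrite subr0; lra.
  rewrite notin_setE /B /= => /negP; rewrite -leNgt => sle _.
  by rewrite (le_trans (ler_normB _ _))//; lra.
have s'g w : s' n w @[n --> \oo] --> g w.
  have [g0|g0] := eqVneq (g w) 0.
    apply: cvg_near_cst; apply: nearW => n; apply/eqP.
    by have := bnd n w; rewrite g0 normr0 mulr0 sub0r normrN normr_le0.
  have gp : 0 < `|g w| by rewrite normr_gt0.
  apply: cvg_trans (sg w); apply: near_eq_cvg.
  have : \forall n \near \oo, `|s n w| < 2 * `|g w|.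
    apply: (@cvgr_lt _ _ _ _ (fun n => `|s n w|) `|g w|); last by lra.
    by apply: cvg_norm.
  apply: filterS => n sn; rewrite /s' memNset//=.
  by rewrite /B/= => /lt_trans/(_ sn); rewrite ltxx.
have mB n : measurable_fun setT (fun w => (`|g w - s' n w|)%:E).
  apply: measurable_normB; first exact: strongly_measurableS mg.
  exact/(strongly_measurableS GT)/simple_strongly_measurable.
have [] := @dominated_convergence _ _ _ mu setT measurableT
  (fun n w => (`|g w - s' n w|)%:E) (cst 0%E) (fun w => (3 * `|g w|)%:E) mB.
- exact: measurable_cst.
- apply: aeW => w _; apply: cvg_EFin; first exact: nearW.
  rewrite -(normr0 X) -(subrr (g w)); apply: cvg_norm.
  by apply: cvgB; [exact: cvg_cst|exact: s'g].
- by under eq_fun do rewrite EFinM; exact: integrableZl.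
- by apply: aeW => w n _; rewrite lee_fin ger0_norm.
by move=> _ _; rewrite integral_cst// mul0e.
Qed.

(** The two estimates of the Bochner integral needed below are cases of this one:
    [t = 0] gives the triangle inequality, [t] constant compares [f] with one
    value on a set where it hardly varies. *)
Lemma bochner_integral_dist A f t (b : X) : measurable A ->
  strongly_measurable measurable f -> simple measurable t ->
  is_bochner_integral mu A f b ->
  (`|b - simple_integral mu A t|%:E <= \int[mu]_(w in A) (`|f w - t w|)%:E)%E.
Proof.
move=> mA mf mt [s [ms s0 sb]].
have mt' := simple_strongly_measurable mt.
have ms' n := simple_strongly_measurable (ms n).
have step n : (`|simple_integral mu A (s n) - simple_integral mu A t|%:E <=
    \int[mu]_(w in A) (`|f w - t w|)%:E +
    \int[mu]_(w in A) (`|f w - s n w|)%:E)%E.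
  rewrite simple_integralB// -ge0_integralD//; last 2 first.
  - exact/measurable_funTS/measurable_normB.
  - exact/measurable_funTS/measurable_normB.
  apply: le_trans (le_norm_simple_integral mu _ mA) _.
    exact: (finitely_valued_comp sigmaT (fun z => z.1 - z.2)
      (finitely_valued_pair sigmaT (ms n) mt)).
  apply: ge0_le_integral => //.
  - exact/measurable_funTS/measurable_normB.
  - by apply: emeasurable_funD; exact/measurable_funTS/measurable_normB.
  move=> w _; rewrite -EFinD lee_fin.
  rewrite (_ : s n w - t w = (f w - t w) - (f w - s n w)).
    exact: ler_normB.
  by rewrite opprB [RHS]addrC addrA subrK.
have cL : (`|simple_integral mu A (s n) - simple_integral mu A t|%:E)%E
    @[n --> \oo] --> (`|b - simple_integral mu A t|%:E)%E.
  apply: cvg_EFin; first exact: nearW.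
  by apply: cvg_norm; apply: cvgB => //; exact: cvg_cst.
have cR : (\int[mu]_(w in A) (`|f w - t w|)%:E +
    \int[mu]_(w in A) (`|f w - s n w|)%:E)%E @[n --> \oo] -->
    (\int[mu]_(w in A) (`|f w - t w|)%:E)%E.
  rewrite -[X in _ --> X]adde0; apply: cvgeD => //; last exact: cvg_cst.
  by rewrite fin_num_adde_defl.
by apply: lee_cvg_to cL cR _; exact: nearW.
Qed.

(** The integrals of the approximating simple functions form a Cauchy sequence,
    so existence rests on completeness of [X]. *)
Lemma bochner_integralP A f : measurable A -> Lp mu 1 f ->
  is_bochner_integral mu A f (bochner_integral mu A f).
Proof.
move=> mA Lf; apply: xgetPex.
have mf := Lf.1.
have [s [ms s0]] := simple_approximation sigmaT (@subset_refl _ _) mf Lf.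
have ms' n := simple_strongly_measurable (ms n).
have sA : (\int[mu]_(w in A) (`|f w - s n w|)%:E)%E @[n --> \oo] --> 0%E.
  apply: (squeeze_cvge _ _ s0); last exact: cvg_cst.
  apply: nearW => n; rewrite integral_ge0//=.
  by apply: ge0_subset_integral => //; exact: measurable_normB.
suff /cauchy_cvg sx : cauchy (simple_integral mu A (s n) @[n --> \oo]).
  by exists (limn (fun n => simple_integral mu A (s n))), s.
apply/cauchyP => e e0.
have e2 : 0 < e / 2 by rewrite divr_gt0.
have : \forall n \near \oo, (\int[mu]_(w in A) (`|f w - s n w|)%:E < (e / 2)%:E)%E.
  have := sA; move=> /fine_cvgP[fin].
  move=> /cvgr_lt /(_ _ e2); apply: filter_app; apply: filterS fin => n fin.
  by rewrite -lte_fin /= fineK.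
move=> [N _ NP]; exists (simple_integral mu A (s N)).
exists N => // n Nn /=.
rewrite -ball_normE /= simple_integralB//.
rewrite -lte_fin (le_lt_trans (le_norm_simple_integral mu _ mA))//.
  exact: (finitely_valued_comp sigmaT (fun z => z.1 - z.2)
      (finitely_valued_pair sigmaT (ms N) (ms n))).
apply: (@le_lt_trans _ _ (\int[mu]_(w in A) (`|f w - s N w|)%:E +
    \int[mu]_(w in A) (`|f w - s n w|)%:E)%E); last first.
  by rewrite [e]splitr EFinD lteD//; apply: NP => /=.
rewrite -ge0_integralD//; last 2 first.
- exact/measurable_funTS/measurable_normB.
- exact/measurable_funTS/measurable_normB.
apply: ge0_le_integral => //.
- exact/measurable_funTS/measurable_normB.
- by apply: emeasurable_funD; exact/measurable_funTS/measurable_normB.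
move=> w _; rewrite -EFinD lee_fin [leRHS]addrC.
rewrite (_ : s N w - s n w = (f w - s n w) - (f w - s N w)).
  exact: ler_normB.
by rewrite opprB [RHS]addrC addrA subrK.
Qed.

Lemma le_norm_bochner_integral A f : measurable A ->
  strongly_measurable measurable f ->
  (`|bochner_integral mu A f|%:E <= \int[mu]_(w in A) (`|f w|)%:E)%E.
Proof.
move=> mA mf; rewrite /bochner_integral.
case: xgetP => [x _ /(bochner_integral_dist mA mf (finitely_valued_cst sigmaT 0))|_].
  rewrite simple_integral_cst// scaler0 subr0.
  by under eq_integral do rewrite subr0.
by rewrite normr0; apply: integral_ge0.
Qed.

(** If [g] were constant, equal to [x], on a set [B] of [G], then
    [\int_B |g| = |\int_B g| = |\int_B f| <= \int_B |f|].  In general, cut [A]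
    along the values of a [G]-simple function [s] close to [g]; on each piece the
    argument holds up to [2 \int_B |g - s|].  This avoids both duality and
    Jensen's inequality. *)
Lemma cond_exp_norm_contraction (G : set (set Omega)) f g A :
  sub_sigma_algebra_of G -> strongly_measurable measurable f ->
  is_cond_exp mu G f g -> G A ->
  (\int[mu]_(w in A) (`|g w|)%:E <= \int[mu]_(w in A) (`|f w|)%:E)%E.
Proof.
move=> [sG GT] mf [Gg Lg gf] GA.
have mA : measurable A by exact: GT.
have mg := Lg.1.
have [s [Gs s0]] := simple_approximation sG GT Gg Lg.
have ms n : simple measurable (s n).
  by case: (Gs n) => ? Gx; split=> // x; exact/GT.
have ms' n := simple_strongly_measurable (ms n).
have mgf : measurable_fun setT (fun w => (`|g w|)%:E).
  exact/measurable_EFinP/strongly_measurable_normT.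
have mff : measurable_fun setT (fun w => (`|f w|)%:E).
  exact/measurable_EFinP/strongly_measurable_normT.
have fiber n x : G (A `&` s n @^-1` [set x]) ->
    (\int[mu]_(w in A `&` s n @^-1` [set x]) (`|g w|)%:E <=
     \int[mu]_(w in A `&` s n @^-1` [set x])
       (2%:E * (`|g w - s n w|)%:E + (`|f w|)%:E))%E.
  set B := A `&` _ => GB; have mB : measurable B by exact: GT.
  have mgx : measurable_fun setT (fun w => (`|g w - x|)%:E).
    by apply: measurable_normB => //; exact: strongly_measurable_cst.
  have tri1 : (\int[mu]_(w in B) (`|g w|)%:E <=
      \int[mu]_(w in B) (`|g w - x|)%:E + `|x|%:E * mu B)%E.
    rewrite -integral_cst// -ge0_integralD//; last 2 first.
    - exact: measurable_funTS.
    - by move=> w _; rewrite lee_fin.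
    apply: ge0_le_integral => //.
    - exact: measurable_funTS.
    - by apply: emeasurable_funD => //; exact: measurable_funTS.
    move=> w _; rewrite -EFinD lee_fin.
    by rewrite -[X in `|X| <= _](subrK x) ler_normD.
  have tri2 : (`|x|%:E * mu B <=
      \int[mu]_(w in B) (`|g w - x|)%:E + \int[mu]_(w in B) (`|f w|)%:E)%E.
    have := bochner_integral_dist mB mg (finitely_valued_cst sigmaT x)
      (bochner_integralP mB Lg).
    rewrite simple_integral_cst// distrC => dist.
    have {dist} := leeD dist (le_norm_bochner_integral mB mf).
    rewrite gf// -EFinD; apply: le_trans.
    rewrite -{1}(fineK (fin_num_measure mu B mB)) -EFinM lee_fin.
    rewrite mulrC -{1}(ger0_norm (fine_ge0 (measure_ge0 mu B))) -normrZ.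
    by rewrite -[X in `|X| <= _](subrK (bochner_integral mu B f)) ler_normD.
  rewrite ge0_integralD//; last 2 first.
  - by apply: measurable_funeM; exact/measurable_funTS/measurable_normB.
  - exact: measurable_funTS.
  rewrite ge0_integralZl//; last exact/measurable_funTS/measurable_normB.
  have -> : (\int[mu]_(w in B) (`|g w - s n w|)%:E =
      \int[mu]_(w in B) (`|g w - x|)%:E)%E.
    by apply: eq_integral => w; rewrite inE => -[_ /= ->].
  apply: le_trans tri1 _.
  move: tri2; move: (\int[mu]_(w in B) (`|g w - x|)%:E)%E => I.
  move: (\int[mu]_(w in B) _)%E => J tri2.
  by rewrite (_ : 2%:E = 1 + 1)%E// ge0_muleDl// !mul1e -addeA leeD2l.
have step n : (\int[mu]_(w in A) (`|g w|)%:E <=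
    2%:E * \int[mu]_w (`|g w - s n w|)%:E + \int[mu]_(w in A) (`|f w|)%:E)%E.
  apply: (@le_trans _ _ (\int[mu]_(w in A)
      (2%:E * (`|g w - s n w|)%:E + (`|f w|)%:E))%E); last first.
    rewrite ge0_integralD//; last 2 first.
    - by apply: measurable_funeM; exact/measurable_funTS/measurable_normB.
    - exact: measurable_funTS.
    rewrite leeD2r// ge0_integralZl//; last exact/measurable_funTS/measurable_normB.
    rewrite lee_wpmul2l//; apply: ge0_subset_integral => //.
    exact: measurable_normB.
  rewrite (ge0_integral_fibers mu (ms n) mA)//.
  rewrite (ge0_integral_fibers mu (ms n) mA); last 2 first.
  - apply: emeasurable_funD => //; apply: measurable_funeM.
    exact: measurable_normB.
  - by move=> w; rewrite adde_ge0// mule_ge0.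
  apply: lee_sum => x _; apply: fiber.
  by apply: sub_sigmaI => //; exact: (Gs n).2.
have cR : (2%:E * \int[mu]_w (`|g w - s n w|)%:E +
    \int[mu]_(w in A) (`|f w|)%:E)%E @[n --> \oo] -->
    (\int[mu]_(w in A) (`|f w|)%:E)%E.
  rewrite -[X in _ --> X]add0e; apply: cvgeD => //; last exact: cvg_cst.
  by rewrite -(mule0 2%:E); exact: cvgeZl.
by apply: lee_cvg_to (cvg_cst _) cR _; exact: nearW.
Qed.

End BochnerIntegral.

(** * Doob's maximal inequality *)

Section MaximalInequalities.
Context {d} {Omega : measurableType d} {R : realType}.
Context (mu : {finite_measure set Omega -> \bar R}).
Implicit Types (E : nat -> set Omega) (l : R) (phi : Omega -> R).

(** Reduces maximal inequalities to finitely many indices; serves both for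
    martingales and for ergodic averages. *)
Lemma level_bound_bigcup E l phi :
  0 <= l -> measurable_fun setT phi -> (forall w, 0 <= phi w) ->
  (forall n, measurable (E n)) ->
  (forall N, (l%:E * mu (\big[setU/set0]_(i < N) E i) <=
    \int[mu]_(w in \big[setU/set0]_(i < N) E i) (phi w)%:E)%E) ->
  (l%:E * mu (\bigcup_n E n) <= \int[mu]_(w in \bigcup_n E n) (phi w)%:E)%E.
Proof.
move=> l0 mphi phi0 mE bnd.
pose U N := \big[setU/set0]_(i < N.+1) E i.
have mU N : measurable (U N) by exact: bigsetU_measurable.
have UE : \bigcup_N U N = \bigcup_n E n by exact: bigcup_bigsetU_bigcup.
have ndU : {homo U : m n / (m <= n)%N >-> (m <= n)%O}.
  by move=> m n mn; apply/subsetPset; exact: subset_bigsetU.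
have cvg_int (k : Omega -> R) : measurable_fun setT k -> (forall w, 0 <= k w) ->
    (\int[mu]_(w in U N) (k w)%:E)%E @[N --> \oo] -->
    (\int[mu]_(w in \bigcup_n E n) (k w)%:E)%E.
  move=> mk k0; rewrite -UE; apply: ge0_nondecreasing_set_cvg_integral => //.
  - by move=> N; apply/measurable_EFinP; exact: measurable_funTS.
  - by move=> N w _; rewrite lee_fin.
rewrite -integral_cst; last exact: bigcup_measurable.
apply: (lee_cvg_to (cvg_int (cst l) (measurable_cst _) (fun=> l0))
  (cvg_int phi mphi phi0)).
by apply: nearW => N; have := bnd N.+1; rewrite -(integral_cst mu (mU N)); exact.
Qed.

(** Induction on [N] adds the set [E N `\` U] of points where the level is first
    passed at time [N]; it belongs to [F N] because the earlier sigma-algebras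
    are contained in [F N]. *)
Lemma first_passage_bound (F : nat -> set (set Omega)) E l phi :
  (forall n, sub_sigma_algebra_of (F n)) ->
  (forall m n, (m <= n)%N -> F m `<=` F n) ->
  measurable_fun setT phi -> (forall w, 0 <= phi w) ->
  (forall n, F n (E n)) ->
  (forall n A, F n A -> A `<=` E n ->
    (l%:E * mu A <= \int[mu]_(w in A) (phi w)%:E)%E) ->
  forall N, (l%:E * mu (\big[setU/set0]_(i < N) E i) <=
    \int[mu]_(w in \big[setU/set0]_(i < N) E i) (phi w)%:E)%E.
Proof.
move=> Fs Fmono mphi phi0 FE bnd.
have mE n : measurable (E n) by exact: (Fs n).2.
elim=> [|N IH]; first by rewrite big_ord0 measure0 mule0 integral_set0.
rewrite big_ord_recr/=; set U := \big[setU/set0]_(i < N) E i in IH *.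
have mU : measurable U by exact: bigsetU_measurable.
have FU : F N U.
  rewrite /U -(bigcup_mkord N E).
  apply: (sub_sigma_bigcup_fin (Fs N).1) => // i /= iN.
  by apply: Fmono (FE i); exact: ltnW.
have FEU : F N (E N `\` U) by apply: (sub_sigmaD (Fs N).1).
have mEU : measurable (E N `\` U) by exact: measurableD.
have disj : [disjoint U & E N `\` U].
  by apply/disj_set2P; rewrite setDE setICA setICr setI0.
have -> : U `|` E N = U `|` (E N `\` U) by rewrite setDE setUIr setUCr setIT.
rewrite measureU//; last exact/disj_set2P.
rewrite ge0_integral_setU//.
- rewrite muleDr ?fin_num_adde_defr ?fin_num_measure//.
  by apply: leeD => //; apply: (bnd N) => // w [].
- by apply/measurable_EFinP; exact: measurable_funTS.
- by move=> w _; rewrite lee_fin.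
Qed.

Lemma superlevel_ereal_sup {I : Type} (g : I -> Omega -> R) l :
  [set w | l%:E < ereal_sup (range (fun n => (g n w)%:E))]%E =
  \bigcup_n [set w | l < g n w].
Proof.
apply/seteqP; split=> w /=.
  by move=> /ereal_sup_gt[_ [n _ <-]]; rewrite lte_fin => lg; exists n.
move=> [n _ /= lg]; apply: (@lt_le_trans _ _ (g n w)%:E); first by rewrite lte_fin.
by apply: ereal_sup_ubound; exists n.
Qed.

Lemma measurable_ereal_sup {I : countType} (g : I -> Omega -> R) :
  (forall i, measurable_fun setT (g i)) ->
  measurable_fun setT (fun w => ereal_sup (range (fun i => (g i w)%:E))).
Proof.
move=> mg mT; apply: (measurability _ (ErealGenOInfty.measurableE R)) => //.
move=> _ [_ [x ->] <-]; rewrite setTI.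
rewrite (_ : _ @^-1` _ = \bigcup_i [set w | x < g i w]).
  apply: countable_bigcupT_measurable; first exact: countableP.
  by move=> i; exact: measurable_ltr_set.
rewrite -superlevel_ereal_sup; apply/seteqP.
by split=> w /=; rewrite in_itv/= andbT.
Qed.

Lemma doob_weak (F : nat -> set (set Omega)) Foo (g : nat -> Omega -> R) l phi :
  (forall n, sub_sigma_algebra_of (F n)) ->
  increases_to F Foo \/ decreases_to F Foo ->
  0 <= l -> measurable_fun setT phi -> (forall w, 0 <= phi w) ->
  (forall n, measurable_fun setT (g n)) ->
  (forall n, F n [set w | l < g n w]) ->
  (forall n A, F n A ->
    (\int[mu]_(w in A) (g n w)%:E <= \int[mu]_(w in A) (phi w)%:E)%E) ->
  (l%:E * mu [set w | l%:E < ereal_sup (range (fun n => (g n w)%:E))] <=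
   \int[mu]_(w in [set w | l%:E < ereal_sup (range (fun n => (g n w)%:E))])
     (phi w)%:E)%E.
Proof.
move=> Fs Fmono l0 mphi phi0 mg Fg gphi.
pose E n := [set w | l < g n w].
have -> : [set w | l%:E < ereal_sup (range (fun n => (g n w)%:E))]%E =
    \bigcup_n E n by exact: superlevel_ereal_sup.
have mE n : measurable (E n) by exact: (Fs n).2.
have bnd n A : F n A -> A `<=` E n ->
    (l%:E * mu A <= \int[mu]_(w in A) (phi w)%:E)%E.
  move=> FA AE; have mA : measurable A by exact: (Fs n).2.
  apply: le_trans (gphi n A FA); rewrite -integral_cst//.
  apply: ge0_le_integral => //.
  - by apply/measurable_EFinP; exact: measurable_funTS.
  - by move=> w /AE; rewrite lee_fin => /ltW.
apply: level_bound_bigcup => // N.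
case: Fmono => -[Fmono _]; first exact: (first_passage_bound Fs).
(* up to [N], a decreasing sequence read backwards is increasing *)
case: N => [|M]; first by rewrite big_ord0 measure0 mule0 integral_set0.
have -> : \big[setU/set0]_(i < M.+1) E i = \big[setU/set0]_(i < M.+1) E (M - i)%N.
  rewrite (reindex_inj rev_ord_inj)/=.
  by apply: eq_bigr => i _; rewrite subSS.
apply: (@first_passage_bound (fun i => F (M - i)%N) (fun i => E (M - i)%N)) => //.
- by move=> m n mn; apply: Fmono; exact: leq_sub2l.
- by move=> n A; exact: bnd.
Qed.

End MaximalInequalities.

(** * The maximal ergodic inequality *)

Section RealL1.
Import HBSimple.
Context {d} {Omega : measurableType d} {R : realType}.
Context (mu : {finite_measure set Omega -> \bar R}).

(** Identifies the [L_1] space of Banach-valued functions, for the Banach space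
    [R], with the usual one; the dominating operator lives on the former and
    Lebesgue integration theory on the latter. *)
Lemma strongly_measurable_realP (h : Omega -> R^o) :
  strongly_measurable measurable h <-> measurable_fun setT (h : Omega -> R).
Proof.
split=> [[s [ms sh]]|mh].
  apply: (@measurable_fun_cvg _ _ _ _ s) => [n _ B mB|w _]; last exact: sh.
  rewrite setTI.
  exact: (finitely_valued_preimage (sigma_algebra_measurable _) B (ms n)).
have mEh : measurable_fun setT (EFin \o (h : Omega -> R)).
  exact/measurable_EFinP.
have [s sh] := approximation_sfun measurableT mEh.
exists (fun n => s n : Omega -> R^o); split=> [n|w].
  by split=> [|x]; [exact: fimfunP|exact: measurable_sfunP].
by have /fine_cvgP[_] := sh w Logic.I.
Qed.

Lemma Lp1_realP (h : Omega -> R^o) :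
  Lp mu 1 h <-> mu.-integrable setT (EFin \o (h : Omega -> R)).
Proof.
rewrite Lp1P strongly_measurable_realP.
split=> [[mh ih]|ih].
  apply: le_integrable ih => //; first exact/measurable_EFinP.
  by move=> w _; rewrite /= normr_id.
have mh : measurable_fun setT (h : Omega -> R).
  by case/integrableP : ih => /measurable_EFinP.
split=> //; exact: (integrable_abse ih).
Qed.
End RealL1.

Section HopfMaximal.
Context {d} {Omega : measurableType d} {R : realType}.
Context (mu : {finite_measure set Omega -> \bar R}).

Lemma Lp1_cst (c : R) : Lp mu 1 (fun=> c : R^o).
Proof. by apply/Lp1_realP; exact: finite_measure_integrable_cst. Qed.

Lemma Lp1_add (f g : Omega -> R^o) :
  Lp mu 1 f -> Lp mu 1 g -> Lp mu 1 (fun w => f w + g w : R^o).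
Proof.
move=> /Lp1_realP If /Lp1_realP Ig; apply/Lp1_realP.
exact: (integrableD measurableT If Ig).
Qed.

Lemma Lp1_scale (c : R) (f : Omega -> R^o) :
  Lp mu 1 f -> Lp mu 1 (fun w => c * f w : R^o).
Proof.
move=> /Lp1_realP If; apply/Lp1_realP.
exact: (integrableZl measurableT c If).
Qed.

Lemma Lp1_max (f g : Omega -> R^o) :
  Lp mu 1 f -> Lp mu 1 g -> Lp mu 1 (fun w => Num.max (f w : R) (g w) : R^o).
Proof.
move=> /Lp1_realP If /Lp1_realP Ig; apply/Lp1_realP.
have /integrableP[/measurable_EFinP mf _] := If.
have /integrableP[/measurable_EFinP mg _] := Ig.
apply: (le_integrable measurableT _ _
  (integrableD measurableT (integrable_abse If) (integrable_abse Ig))).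
  by apply/measurable_EFinP; exact: measurable_maxr.
move=> w _ /=; rewrite lee_fin [leRHS]ger0_norm ?addr_ge0//.
by rewrite /Num.max; case: ifP => _; rewrite ?lerDl ?lerDr.
Qed.

Context (P : (Omega -> R^o) -> Omega -> R^o).
Hypothesis P_linear : L1_linear_operator mu P.
Hypothesis P_positive : L1_positive mu P.

Lemma L1_operatorD (f g : Omega -> R^o) : Lp mu 1 f -> Lp mu 1 g ->
  \forall w \ae mu, P (fun w => f w + g w) w = P f w + P g w.
Proof.
move=> Lf Lg; have [_ _ lin] := P_linear.
have := lin 1 f g Lf Lg.
rewrite (_ : (fun w => 1 *: f w + g w) = (fun w => f w + g w)); last first.
  by apply/funext => w; rewrite scale1r.
by apply: filterS => w /(_ Logic.I) ->; rewrite scale1r.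
Qed.

Lemma L1_operator_le (f g : Omega -> R^o) : Lp mu 1 f -> Lp mu 1 g ->
  {ae mu, forall w, (f w : R) <= g w} -> {ae mu, forall w, (P f w : R) <= P g w}.
Proof.
move=> Lf Lg fg; have [_ _ lin] := P_linear.
have Lh : Lp mu 1 (fun w => -1 *: f w + g w).
  exact: (Lp1_add (Lp1_scale (-1) Lf) Lg).
have hP : {ae mu, forall w, (0 : R) <= (-1 *: f w + g w : R^o)}.
  by apply: filterS fg => w fgw; rewrite scaleN1r addrC subr_ge0.
have := P_positive Lh hP.
apply: filterS2 (lin (-1) f g Lf Lg) => w /(_ Logic.I) ->.
by rewrite scaleN1r addrC subr_ge0.
Qed.

Lemma L1_operator_iter h i : Lp mu 1 h -> Lp mu 1 (iter i P h).
Proof. by have [PL _ _] := P_linear; move=> Lh; elim: i => //= i /PL. Qed.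

Definition orbit_sum (h : Omega -> R^o) (k : nat) : Omega -> R^o :=
  fun w => \sum_(i < k) iter i P h w.

Lemma Lp1_orbit_sum h k : Lp mu 1 h -> Lp mu 1 (orbit_sum h k).
Proof.
move=> Lh; elim: k => [|k IH].
  rewrite (_ : orbit_sum h 0 = fun=> 0); first exact: Lp1_cst.
  by apply/funext => w; rewrite /orbit_sum big_ord0.
rewrite (_ : orbit_sum h k.+1 = fun w => orbit_sum h k w + iter k P h w).
  by apply: Lp1_add => //; exact: L1_operator_iter.
by apply/funext => w; rewrite /orbit_sum big_ord_recr.
Qed.

(** Operators on [L_1] act on representatives, so additivity, and with it this
    recursion, holds only almost everywhere. *)
Lemma orbit_sumS h k : Lp mu 1 h ->
  \forall w \ae mu, orbit_sum h k.+1 w = h w + P (orbit_sum h k) w.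
Proof.
move=> Lh; elim: k => [|k IH].
  have -> : orbit_sum h 0 = fun=> 0.
    by apply/funext => w; rewrite /orbit_sum big_ord0.
  have := L1_operatorD (Lp1_cst 0) (Lp1_cst 0).
  rewrite (_ : (fun _ => 0 + 0 : R^o) = (fun=> 0)); last first.
    by apply/funext => w; rewrite addr0.
  apply: filterS => w /esym/eqP; rewrite -subr_eq0 addrK => /eqP ->.
  by rewrite /orbit_sum big_ord_recr big_ord0/= add0r addr0.
have SE w : orbit_sum h k.+1 w = orbit_sum h k w + iter k P h w.
  by rewrite /orbit_sum big_ord_recr.
have -> : orbit_sum h k.+1 = fun w => orbit_sum h k w + iter k P h w.
  by apply/funext.
have := L1_operatorD (Lp1_orbit_sum k Lh) (L1_operator_iter k Lh).
apply: filterS2 IH => w IH ->.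
by rewrite addrA -IH /orbit_sum [LHS]big_ord_recr.
Qed.

Hypothesis P_contraction : L1_contraction mu P.
Hypothesis P_Loo : forall h, Lp mu 1 h -> (Lpnorm mu +oo (P h) <= Lpnorm mu +oo h)%E.

(** When [mu] is the zero measure the [L_oo] norm is [0] by convention and says
    nothing, but then every property holds almost everywhere. *)
Lemma Loo_contraction_cst (c : R) : 0 <= c ->
  {ae mu, forall w, (P (fun=> c) w : R) <= c}.
Proof.
move=> c0; have := P_Loo (Lp1_cst c).
rewrite /Lpnorm unlock /Lnorm; case: ifPn => [mu0|mu0 _].
  move=> Pc.
  have /ess_supP :
      (ess_sup mu (abse \o (fun w => (`|P (fun=> c) w|)%:E)) <= c%:E)%E.
    apply: le_trans Pc _; apply/ess_supP; apply: aeW => w /=.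
    by rewrite normr_id ger0_norm.
  apply: filterS => w; rewrite /= normr_id lee_fin.
  exact/le_trans/ler_norm.
have {}mu0 : mu setT = 0%E.
  by apply/eqP; move: mu0; rewrite lt_neqAle measure_ge0 andbT negbK eq_sym.
by exists setT; split.
Qed.

(** The function [max_(0 <= k <= N) (orbit_sum h k - k l)] of Garsia's proof, for
    the excess of the orbit sums over the level [l].  It is positive exactly where
    one of the first [N] averages exceeds [l]. *)
Fixpoint running_excess (h : Omega -> R^o) (l : R) (N : nat) : Omega -> R^o :=
  if N is k.+1 then
    fun w => Num.max (running_excess h l k w : R) (orbit_sum h N w - N%:R * l)
  else fun=> 0.

Lemma running_excess_ge0 h l N w : 0 <= (running_excess h l N w : R).
Proof. by elim: N => //= N IH; rewrite le_max IH. Qed.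

Lemma running_excess_le h l N k w : (k <= N)%N ->
  (orbit_sum h k w - k%:R * l : R) <= running_excess h l N w.
Proof.
elim: N k => [|N IH] k.
  by rewrite leqn0 => /eqP ->; rewrite /orbit_sum big_ord0 mul0r subr0.
rewrite leq_eqVlt => /predU1P[->|kN] /=; rewrite le_max.
  by rewrite lexx orbT.
by rewrite IH.
Qed.

Lemma running_excess_attained h l N w : 0 < (running_excess h l N w : R) ->
  exists2 k, (k < N)%N &
    running_excess h l N w = orbit_sum h k.+1 w - k.+1%:R * l.
Proof.
elim: N => [|N IH] /=; first by rewrite ltxx.
rewrite /Num.max; case: ifP => _ H; first by exists N.
by have [k kN ->] := IH H; exists k => //; exact: ltnW.
Qed.

Lemma Lp1_running_excess h l N : Lp mu 1 h -> Lp mu 1 (running_excess h l N).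
Proof.
move=> Lh; elim: N => [|N IH]; first exact: Lp1_cst.
apply: Lp1_max => //; apply: Lp1_add (Lp1_cst _); exact: Lp1_orbit_sum.
Qed.

(** From [orbit_sum h k <= M + k l], monotonicity of [P] and [P (k l) <= k l],
    [orbit_sum h (k+1) = h + P (orbit_sum h k) <= h + P M + k l].  The bound on
    constants comes from the [L_oo] contraction. *)
Lemma running_excess_step h l N : 0 <= l -> Lp mu 1 h ->
  {ae mu, forall w, forall k, (k < N)%N ->
    (orbit_sum h k.+1 w - k.+1%:R * l : R) <= h w - l + P (running_excess h l N) w}.
Proof.
move=> l0 Lh; apply/ae_foralln => k.
have [kN|kN] := ltnP k N; last by apply: aeW => w.
have LM := Lp1_running_excess l N Lh.
have kl0 : 0 <= k%:R * l by rewrite mulr_ge0.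
have LMc := Lp1_add LM (Lp1_cst (k%:R * l)).
have le1 : {ae mu, forall w, (orbit_sum h k w : R) <=
    running_excess h l N w + k%:R * l}.
  by apply: aeW => w; rewrite -lerBlDr; apply: running_excess_le; exact: ltnW.
have le2 := L1_operator_le (Lp1_orbit_sum k Lh) LMc le1.
apply: (filter_app _ _ le2).
apply: filterS3 (orbit_sumS k Lh) (L1_operatorD LM (Lp1_cst (k%:R * l)))
  (Loo_contraction_cst kl0) => w -> Dw cw le2w _.
rewrite Dw in le2w; rewrite -natr1 mulrDl mul1r; lra.
Qed.

(** Garsia's argument.  With [M] the running excess and [U = {M > 0}],
    [running_excess_step] gives [M + l <= h + P M] on [U].  Integrate over [U]:
    since [M] vanishes off [U] and [P] is a contraction,
    [\int_U |P M| <= \int M = \int_U M], and [\int_U M] cancels. *)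
Lemma hopf_weak_fin (h : Omega -> R^o) l N :
  0 <= l -> Lp mu 1 h -> (forall w, 0 <= (h w : R)) ->
  (l%:E * mu [set w | 0 < (running_excess h l N w : R)]%R <=
    \int[mu]_(w in [set w | 0 < (running_excess h l N w : R)]%R) (h w)%:E)%E.
Proof.
move=> l0 Lh h0; set U := [set w | _]; set M := running_excess h l N in U *.
have LM : Lp mu 1 M by exact: Lp1_running_excess.
have LPM : Lp mu 1 (P M) by have [PL _ _] := P_linear; exact: PL.
have M0 w : 0 <= (M w : R) by exact: running_excess_ge0.
have mM : measurable_fun setT (M : Omega -> R).
  by apply/strongly_measurable_realP; case: LM.
have mPM : measurable_fun setT (P M : Omega -> R).
  by apply/strongly_measurable_realP; case: LPM.
have mh : measurable_fun setT (h : Omega -> R).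
  by apply/strongly_measurable_realP; case: Lh.
have mU : measurable U by exact: measurable_ltr_set.
have mnPM : measurable_fun U (fun w => (`|P M w|)%:E).
  by apply/measurable_EFinP; apply: measurable_funTS; exact: measurableT_comp.
have mMU : measurable_fun U (fun w => (M w)%:E).
  by apply/measurable_EFinP; exact: measurable_funTS.
have mhU : measurable_fun U (fun w => (h w)%:E).
  by apply/measurable_EFinP; exact: measurable_funTS.
have garsia : (\int[mu]_(w in U) ((M w)%:E + cst l%:E w) <=
    \int[mu]_(w in U) ((h w)%:E + (`|P M w|)%:E))%E.
  apply: ae_ge0_le_integral => //.
  - by move=> w _; rewrite adde_ge0// lee_fin.
  - exact: emeasurable_funD.
  - by move=> w _; rewrite adde_ge0// lee_fin.
  - exact: emeasurable_funD.
  apply: filterS (running_excess_step N l0 Lh) => w step Uw.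
  have [k kN Mk] := running_excess_attained Uw.
  have := step k kN; rewrite -Mk -!EFinD lee_fin -/M => stepk.
  have := ler_norm (P M w : R); lra.
move: garsia; rewrite !ge0_integralD//; last 2 first.
- by move=> w _; rewrite lee_fin.
- by move=> w _; rewrite lee_fin.
have PM_le : (\int[mu]_(w in U) (`|P M w|)%:E <= \int[mu]_(w in U) (M w)%:E)%E.
  apply: (@le_trans _ _ (\int[mu]_w (`|P M w|)%:E)%E).
    apply: ge0_subset_integral => //.
    by apply/measurable_EFinP; exact: measurableT_comp.
  have := P_contraction LM; rewrite /Lpnorm !Lnorm1.
  under eq_integral do rewrite abse_EFin normr_id.
  move=> /le_trans; apply.
  rewrite [leRHS]integral_mkcond; apply: ge0_le_integral => //.
  - apply/measurable_EFinP; apply: measurableT_comp => //.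
    exact: measurableT_comp.
  - apply/(measurable_restrictT _ mU) => //.
  move=> w _; rewrite /= normr_id ger0_norm// patchE; case: ifPn => //.
  by rewrite notin_setE /U /= => /negP; rewrite -leNgt.
rewrite integral_cst// => garsia.
have Mfin : (\int[mu]_(w in U) (M w)%:E)%E \is a fin_num.
  apply: integrable_fin_num => //.
  exact: (integrableS measurableT mU (@subsetT _ _) ((Lp1_realP mu M).1 LM)).
rewrite -(@leeD2lE _ (\int[mu]_(w in U) (M w)%:E)%E)//.
by apply: le_trans garsia _; rewrite [leRHS]addeC; exact: leeD2l.
Qed.

End HopfMaximal.

(** * Ergodic averages of dominated operators *)

Section ErgodicAverages.
Context {d} {Omega : measurableType d} {R : realType}.
Context (mu : {finite_measure set Omega -> \bar R}).

Definition ergodic_sup (P : (Omega -> R^o) -> Omega -> R^o) (h : Omega -> R^o) :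
    Omega -> \bar R :=
  fun w => ereal_sup (range (fun n => (ergodic_average P n.+1 h w : R)%:E)).

Lemma ergodic_maximal_weak (P : (Omega -> R^o) -> Omega -> R^o)
    (h : Omega -> R^o) (l : R) :
  L1_linear_operator mu P -> L1_positive mu P -> L1_Loo_contraction mu P ->
  0 < l -> Lp mu 1 h -> (forall w, 0 <= (h w : R)) ->
  (l%:E * mu [set w | (l%:E < ergodic_sup P h w)%E] <=
    \int[mu]_(w in [set w | (l%:E < ergodic_sup P h w)%E]) (h w)%:E)%E.
Proof.
move=> Plin Ppos [Pcon PLoo] l0 Lh h0.
pose E n := [set w | l < (ergodic_average P n.+1 h w : R)].
have -> : [set w | (l%:E < ergodic_sup P h w)%E] = \bigcup_n E n.
  exact: superlevel_ereal_sup.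
have aveE n w : (l < (ergodic_average P n.+1 h w : R)) =
    (0 < (orbit_sum P h n.+1 w : R) - n.+1%:R * l).
  by rewrite subr_gt0 mulrC -ltr_pdivlMr ?ltr0n// mulrC.
have mh : measurable_fun setT (h : Omega -> R).
  by apply/strongly_measurable_realP; case: Lh.
have mE n : measurable (E n).
  apply: measurable_ltr_set => //.
  have /strongly_measurable_realP := (Lp1_orbit_sum Plin n.+1 Lh).1.
  by move=> mS; apply: measurable_funM.
apply: level_bound_bigcup => //; first exact: ltW.
move=> N; have := hopf_weak_fin Plin Ppos Pcon PLoo N (ltW l0) Lh h0.
suff -> : [set w | 0 < (running_excess P h l N w : R)] =
    \big[setU/set0]_(i < N) E i by [].
rewrite -bigcup_mkord; apply/seteqP; split=> w /=.
  move=> M0; have [k kN Mk] := running_excess_attained M0.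
  by exists k => //=; rewrite /E /= aveE -Mk.
move=> [k /= kN]; rewrite /E /= aveE => /lt_le_trans; apply.
exact: running_excess_le.
Qed.

Context {X : completeNormedModType R}.

Lemma strongly_measurable_average (T : (Omega -> X) -> Omega -> X) n g :
  L1_linear_operator mu T -> Lp mu 1 g ->
  strongly_measurable measurable (ergodic_average T n g).
Proof.
move=> [TL _ _] Lg.
have Li i : Lp mu 1 (iter i T g) by elim: i => //= i /TL.
have mS : strongly_measurable measurable (fun w => \sum_(i < n) iter i T g w).
  elim: n => [|n IH].
    under eq_fun do rewrite big_ord0.
    exact: strongly_measurable_cst (sigma_algebra_measurable _).
  under eq_fun do rewrite big_ord_recr /= -[X in X + _]scale1r.
  by apply: strongly_measurableZD => //; case: (Li n).
have := strongly_measurableZD n%:R^-1 (sigma_algebra_measurable _) mS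
  (strongly_measurable_cst (0 : X) (sigma_algebra_measurable _)).
by under eq_fun do rewrite addr0.
Qed.

Lemma dominated_average (T : (Omega -> X) -> Omega -> X)
    (P : (Omega -> R^o) -> Omega -> R^o) (g : Omega -> X) (h : Omega -> R^o) n :
  L1_linear_operator mu T -> positive_dominant mu T P ->
  Lp mu 1 g -> Lp mu 1 h -> {ae mu, forall w, `|g w| <= (h w : R)} ->
  {ae mu, forall w, `|ergodic_average T n g w| <= (ergodic_average P n h w : R)}.
Proof.
move=> [TL _ _] [Plin Ppos _ TP] Lg Lh gh.
have LT i : Lp mu 1 (iter i T g) by elim: i => //= i /TL.
have Ln i : Lp mu 1 (fun w => `|iter i T g w| : R^o).
  by apply/Lp1_realP; have [_] := (Lp1P mu _).1 (LT i).
have iter_le i : {ae mu, forall w, `|iter i T g w| <= (iter i P h w : R)}.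
  elim: i => [//|i IH].
  have le1 := L1_operator_le Plin Ppos (Ln i) (L1_operator_iter Plin i Lh) IH.
  by apply: filterS2 (TP _ (LT i)) le1 => w; exact: le_trans.
have := ae_foralln iter_le.
apply: filterS => w le_w; rewrite /ergodic_average normrZ ger0_norm ?invr_ge0//.
apply: ler_wpM2l; first by rewrite invr_ge0.
by apply: le_trans (ler_norm_sum _ _ _) _; apply: ler_sum.
Qed.

End ErgodicAverages.

(** * Proof of the double maximal inequality *)

Lemma ereal_sup_range_ge0 {R : realType} {I : Type} (g : I -> R) (i : I) :
  0 <= g i -> (0 <= ereal_sup (range (fun j => (g j)%:E)))%E.
Proof.
move=> gi; apply: (@le_trans _ _ (g i)%:E); first by rewrite lee_fin.
by apply: ereal_sup_ubound; exists i.
Qed.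

Lemma le_measure_ae {d} {T : measurableType d} {R : realType}
    (mu : {measure set T -> \bar R}) (A B : set T) :
  measurable A -> measurable B -> {ae mu, forall w, A w -> B w} ->
  (mu A <= mu B)%E.
Proof.
move=> mA mB AB; rewrite -[A]setIT -[B]setIT -!integral_indic//.
apply: ae_ge0_le_integral => //.
- exact/measurable_EFinP/measurable_indic.
- exact/measurable_EFinP/measurable_indic.
apply: filterS AB => w AB _; rewrite lee_fin !indicE.
by have [/set_mem/AB/mem_set ->|] := boolP (w \in A).
Qed.

Section DoobMaximal.
Context {d} {Omega : measurableType d} {R : realType}.
Context (mu : {finite_measure set Omega -> \bar R}).
Context {X : completeNormedModType R}.

Lemma doob_Lp (F : nat -> set (set Omega)) (Foo : set (set Omega)) (p : R)
    (f : Omega -> X) (Ef : nat -> Omega -> X) :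
  (forall n, sub_sigma_algebra_of (F n)) ->
  increases_to F Foo \/ decreases_to F Foo -> 1 < p ->
  strongly_measurable measurable f -> (forall n, is_cond_exp mu (F n) f (Ef n)) ->
  (\int[mu]_w (ereal_sup (range (fun n => (`|Ef n w|)%:E)) `^ p) <=
    ((p / (p - 1)) `^ p)%:E * \int[mu]_w (`|f w| `^ p)%:E)%E.
Proof.
move=> Fs Fmono p1 mf EfP.
have mEf n : measurable_fun setT (fun w => `|Ef n w|).
  by have [_ [mE _] _] := EfP n; exact: strongly_measurable_normT.
have mnf := strongly_measurable_normT mf.
apply: strong_of_weak => //.
- exact: measurable_ereal_sup.
- by move=> w; exact: (@ereal_sup_range_ge0 _ _ (fun n => `|Ef n w|) 0%N).
move=> l l0; apply: (doob_weak Fs Fmono (ltW l0)) => // n.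
- have [Fn _ _] := EfP n; have sG := (Fs n).1.
  rewrite -(measurable_g_measurableTypeE sG).
  apply: (@measurable_ltr_set _ _ (g_sigma_algebraType (F n))) => //.
  exact: strongly_measurable_norm.
- by move=> A FA; exact: cond_exp_norm_contraction (Fs n) mf (EfP n) FA.
Qed.

End DoobMaximal.

(* F k and Ef k stand for F_{k+1} and E(f | F_{k+1}); n.1 and n.2 likewise
   start at 0. *)
Theorem theorem3p7 (R : realType) (X : completeNormedModType R)
    (X_reflexive : reflexive_space X)
    (d : measure_display) (Omega : measurableType d)
    (mu : {finite_measure set Omega -> \bar R})
    (F : nat -> set (set Omega)) (Foo : set (set Omega))
    (F_sub : forall n, sub_sigma_algebra_of (F n))
    (F_monotone : increases_to F Foo \/ decreases_to F Foo)
    (T : (Omega -> X) -> Omega -> X)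
    (T_linear : L1_linear_operator mu T)
    (T_dominated : exists T' : (Omega -> R^o) -> Omega -> R^o,
        positive_dominant mu T T' /\ L1_Loo_contraction mu T')
    (p : R) (p_gt1 : 1 < p)
    (f : Omega -> X) (f_Lp : Lp mu p%:E f)
    (Ef : nat -> Omega -> X)
    (Ef_cond_exp : forall n, is_cond_exp mu (F n) f (Ef n))
    (sup_Ef_L1 : mu.-integrable setT
        (fun w => ereal_sup (range (fun n : nat => (`|Ef n w|)%:E)))) :
  let Sf_sup : Omega -> \bar R := fun w =>
    ereal_sup (range (fun n : nat * nat =>
      (`|ergodic_average T n.1.+1 (Ef n.2) w|)%:E)) in
  (Lnorm mu p%:E Sf_sup <= ((p / (p - 1)) ^+ 2)%:E * Lpnorm mu p%:E f)%E /\
  (forall eps : R, 0 < eps ->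
    (mu [set w | eps%:E <= Sf_sup w] <=
     ((p / (p - 1)) `^ p)%:E * (Lpnorm mu p%:E f `^ p / (eps `^ p)%:E))%E).
Proof.
move=> Sf_sup.
have [P [TP [Pcon PLoo]]] := T_dominated.
have [Plin Ppos _ _] := TP.
have [mf _] := f_Lp.
have p0 : 0 < p by exact: lt_trans p_gt1.
set q := p / (p - 1).
have q0 : 0 < q by rewrite divr_gt0// subr_gt0.
have mnf : measurable_fun setT (fun w => `|f w|) by exact: strongly_measurable_normT.
have LEf n : Lp mu 1 (Ef n) by case: (Ef_cond_exp n).
pose s w := ereal_sup (range (fun n => (`|Ef n w|)%:E)).
have s0 w : (0 <= s w)%E.
  exact: (@ereal_sup_range_ge0 _ _ (fun n => `|Ef n w|) 0%N).
(* [s] is finite a.e. because it is integrable; [P] acts on real functions *)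
pose h : Omega -> R^o := fun w => fine (s w).
have h0 w : 0 <= (h w : R) by exact: fine_ge0.
have ms : measurable_fun setT s by case/integrableP: sup_Ef_L1.
have mh : measurable_fun setT (h : Omega -> R).
  exact: (measurableT_comp (fine_measurable measurableT) ms).
have hs w : ((h w : R)%:E <= s w)%E.
  rewrite /h; have := s0 w; case: (s w) => [r|_|]/=; [by []|by rewrite leey|].
  by rewrite leeNy_eq.
have Lh : Lp mu 1 h.
  apply/Lp1_realP; apply: (le_integrable measurableT _ _ sup_Ef_L1).
    exact/measurable_EFinP.
  move=> w _; rewrite (gee0_abs (s0 w)) /= ger0_norm//; exact: hs.
have Efh n : {ae mu, forall w, `|Ef n w| <= (h w : R)}.
  apply: filterS (integrable_ae measurableT sup_Ef_L1) => w /(_ Logic.I) sfin.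
  rewrite -lee_fin /h fineK//; apply: ereal_sup_ubound; by exists n.
pose U := ergodic_sup P h.
have maveP n : measurable_fun setT (ergodic_average P n h : Omega -> R).
  apply/strongly_measurable_realP.
  exact: (@strongly_measurable_average _ _ _ mu R^o P n h Plin Lh).
have mU : measurable_fun setT U by apply: measurable_ereal_sup => n; exact: maveP.
have mS : measurable_fun setT Sf_sup.
  apply: measurable_ereal_sup => n; apply: strongly_measurable_normT.
  exact: (strongly_measurable_average _ T_linear).
have S0 w : (0 <= Sf_sup w)%E.
  exact: (@ereal_sup_range_ge0 _ _
    (fun n : nat * nat => `|ergodic_average T n.1.+1 (Ef n.2) w|) (0%N, 0%N)).
have U0 w : (0 <= U w)%E.
  apply: (@ereal_sup_range_ge0 _ _ (fun n => ergodic_average P n.+1 h w : R) 0%N).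
  by rewrite /ergodic_average big_ord_recr big_ord0/= add0r invr1 scale1r.
have SU : {ae mu, forall w, (Sf_sup w <= U w)%E}.
  have dom n : {ae mu, forall w,
      `|ergodic_average T n.1.+1 (Ef n.2) w| <= (ergodic_average P n.1.+1 h w : R)}.
    exact: (dominated_average n.1.+1 T_linear TP (LEf n.2) Lh (Efh n.2)).
  (* pairs are enumerated by [pickle] to get one exceptional null set *)
  have /ae_foralln domN : forall m : nat, {ae mu, forall w, forall n : nat * nat,
      unpickle m = Some n ->
      `|ergodic_average T n.1.+1 (Ef n.2) w| <= (ergodic_average P n.1.+1 h w : R)}.
    move=> m; case: (unpickle m : option (nat * nat)) => [n|]; last by apply: aeW.
    by apply: filterS (dom n) => w le_w _ [<-].
  apply: filterS domN => w le_w; apply: ub_ereal_sup => _ [n _ <-].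
  apply: (@le_trans _ _ (ergodic_average P n.1.+1 h w : R)%:E).
    by rewrite lee_fin; apply: (le_w (pickle n)); rewrite pickleK.
  by apply: ereal_sup_ubound; exists n.1.
have weak l : 0 < l -> (l%:E * mu [set w | (l%:E < U w)%E] <=
    \int[mu]_(w in [set w | (l%:E < U w)%E]) (h w)%:E)%E.
  by move=> l0; exact: (ergodic_maximal_weak Plin Ppos (conj Pcon PLoo)).
have hf : (\int[mu]_w (h w `^ p)%:E <= (q `^ p)%:E * \int[mu]_w (`|f w| `^ p)%:E)%E.
  apply: le_trans (doob_Lp F_sub F_monotone p_gt1 mf Ef_cond_exp).
  apply: ge0_le_integral => //.
  - by move=> w _; rewrite lee_fin powR_ge0.
  - by apply/measurable_EFinP; exact: (measurableT_comp (measurable_powR p) mh).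
  - exact: (measurableT_comp (measurable_poweR p) ms).
  - move=> w _; rewrite -poweR_EFin.
    by rewrite gt0_ler_poweR ?in_itv/= ?leey ?s0 ?lee_fin ?h0 ?(ltW p0) ?hs.
have fE : (Lpnorm mu p%:E f `^ p = \int[mu]_w (`|f w| `^ p)%:E)%E.
  rewrite /Lpnorm poweR_Lnorm ?gt_eqF//.
  by apply: eq_integral => w _; rewrite abse_EFin normr_id poweR_EFin.
split.
- have SI : (\int[mu]_w (Sf_sup w `^ p) <=
      ((q ^+ 2) `^ p)%:E * Lpnorm mu p%:E f `^ p)%E.
    apply: (@le_trans _ _ (\int[mu]_w (U w `^ p))%E).
      apply: ae_ge0_le_integral => //.
      - by move=> w _; exact: poweR_ge0.
      - exact: (measurableT_comp (measurable_poweR p) mS).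
      - by move=> w _; exact: poweR_ge0.
      - exact: (measurableT_comp (measurable_poweR p) mU).
      apply: filterS SU => w SUw _.
      by rewrite gt0_ler_poweR ?in_itv/= ?leey ?S0 ?U0 ?(ltW p0).
    apply: le_trans (strong_of_weak p_gt1 mU mh U0 h0 weak) _.
    have -> : (q ^+ 2) `^ p = q `^ p * q `^ p by rewrite expr2 powRM// ltW.
    rewrite fE EFinM -muleA.
    by rewrite lee_wpmul2l// lee_fin powR_ge0.
  rewrite [leLHS](_ : _ = (\int[mu]_w (Sf_sup w `^ p)) `^ p^-1)%E; last first.
    rewrite unlock /Lnorm; congr (_ `^ _)%E.
    by apply: eq_integral => w _; rewrite gee0_abs.
  have q2 : (0 <= (q ^+ 2)%:E)%E by rewrite lee_fin exprn_ge0// ltW.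
  have N0 : (0 <= Lpnorm mu p%:E f)%E by exact: Lnorm_ge0.
  rewrite -[leRHS]poweRe1 ?mule_ge0// -(divff (lt0r_neq0 p0)) poweRrM.
  rewrite poweRM// poweR_EFin.
  rewrite gt0_ler_poweR ?in_itv/= ?leey ?invr_ge0 ?(ltW p0) ?andbT//.
    by apply: integral_ge0 => w _; exact: poweR_ge0.
  by rewrite mule_ge0 ?poweR_ge0// lee_fin powR_ge0.
- move=> eps e0.
  have mle (V : Omega -> \bar R) : measurable_fun setT V ->
      measurable [set w | (eps%:E <= V w)%E].
    move=> mV; rewrite -[X in measurable X]setTI.
    exact: (measurable_lee measurableT (measurable_cst _) mV).
  apply: (@le_trans _ _ (mu [set w | (eps%:E <= U w)%E])).
    apply: le_measure_ae; [exact: mle|exact: mle|].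
    by apply: filterS SU => w SUw /= /le_trans; apply.
  have ep0 : 0 < eps `^ p by exact: powR_gt0.
  have := le_trans (weak_Lp_of_weak_ge p_gt1 e0 mU mh h0 weak) hf.
  rewrite -fE inver gt_eqF// muleA lee_pdivlMr// muleC.
  exact.
Qed.
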